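(* Let $c=5/4$, $\alpha>2$, $\lambda_b>0$, $P>0$, $\tilde\sigma^2\ge 0$, $\omega>0$ be constants, let $K\ge 1$ be an integer and $r\in\{1,\dots,2K\}$. Let $D_1,\dots,D_{2K}$ be i.i.d. random variables with density $f_d(x)=2c\lambda_b\pi x e^{-c\lambda_b\pi x^2}$, $x\ge0$, and let $d$ be the $r$-th smallest of them. For $s\in\mathbb{C}$ with $\mathrm{Re}(s)>0$ define $$\varphi(s)=\mathbb{E}\left\{\exp\left(-\frac{\tilde\sigma^2}{P}\,s\,d^{\alpha}-\pi\lambda_b\,\omega\, d^2 s^{2/\alpha}\right)\right\}.$$ Then $$\varphi(s)=c\,r\binom{2K}{r}\sum_{l=0}^{r-1}\frac{(-1)^l\binom{r-1}{l}\,H_{1,1}^{1,1}\left(\frac{\tilde\sigma^2}{P}\,s\left(\pi\lambda_b\left((2K-r+l+1)c+\omega s^{2/\alpha}\right)\right)^{-\alpha/2}\right)}{(2K-r+l+1)c+\omega s^{2/\alpha}},$$ where $H_{1,1}^{1,1}(x)$ denotes $H_{1,1}^{1,1}\left(x\,\middle|\,\begin{smallmatrix}(0,\alpha/2)\\(0,1)\end{smallmatrix}\right)$. Moreover, for fixed $s$, in the limit $\tilde\sigma^2/P\to0$, $$\varphi(s)\to c\,r\binom{2K}{r}\sum_{l=0}^{r-1}\frac{(-1)^l\binom{r-1}{l}}{(2K-r+l+1)c+\omega s^{2/\alpha}}.$$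
   Context: Model: base stations form a homogeneous Poisson point process of intensity $\lambda_b$; user-to-serving-BS distances are modeled as i.i.d. with density $f_d$. Under distance-based NOMA grouping, the $2K$ users of a cell are ranked in increasing order of distance, and $d$ is the distance of the user of rank $r$. $\tilde\sigma^2=\sigma^2\|\mathbf u\|^2$ is filtered noise power, $P$ transmit power per stream, and $\omega>0$ an interference-related constant (in the paper $\Gamma(1-2/\alpha)(\frac{\rho_I}{P}|\mathbf u^{\mathrm H}\mathbf 1|^2)^{2/\alpha}$), held fixed. Principal branches are used for complex powers. Fox H-function: $H_{1,1}^{1,1}\left(x\,\middle|\,\begin{smallmatrix}(0,\alpha/2)\\(0,1)\end{smallmatrix}\right)=\frac{1}{2\pi \mathrm{i}}\int_{\mathcal L}\Gamma(\xi)\Gamma(1-\tfrac{\alpha}{2}\xi)x^{-\xi}d\xi$, with $\mathcal L$ a vertical line $\mathrm{Re}(\xi)=\gamma$, $0<\gamma<2/\alpha$.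
   Formalization: When σ̃²=0 the argument of H is 0, where the contour integral defining H is undefined; the formal statement sets H(0)=1, its continuous extension, and is otherwise as stated. *)

(* Defs.v *)
From HB Require Import structures.
From mathcomp Require Import all_boot all_order all_algebra.
From mathcomp Require Import all_classical all_reals all_analysis.
From mathcomp Require Import complex.
Set Implicit Arguments. Unset Strict Implicit. Unset Printing Implicit Defensive.
Import Order.TTheory GRing.Theory Num.Theory.
Import numFieldNormedType.Exports.
Local Open Scope classical_set_scope.
Local Open Scope ring_scope.
Local Open Scope complex_scope.

Section ComplexFunctions.
Variable R : realType.
Notation C := R[i].

Definition cexp (z : C) : C :=
  (expR (complex.Re z))%:C * (cos (complex.Im z) +i* sin (complex.Im z)).

(** principal argument, in (-pi, pi] (atan2 convention; carg 0 = 0) *)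
Definition carg (z : C) : R :=
  let a := complex.Re z in let b := complex.Im z in
  if 0 < a then atan (b / a)
  else if a < 0 then (if 0 <= b then atan (b / a) + pi else atan (b / a) - pi)
  else if 0 < b then pi / 2 else if b < 0 then - (pi / 2) else 0.

Definition cLog (z : C) : C :=
  ln (Num.sqrt (complex.Re z ^+ 2 + complex.Im z ^+ 2)) +i* carg z.

Definition cpow (z w : C) : C := if z == 0 then 0 else cexp (w * cLog z).

(** Euler Gamma function, for Re z > 0:
    Gamma z = \int_0^oo t^(z-1) e^(-t) dt, split in real and imaginary parts. *)
Definition cGamma (z : C) : C :=
  (Rintegral lebesgue_measure [set t : R | 0 < t]
     (fun t => t `^ (complex.Re z - 1) * expR (- t) * cos (complex.Im z * ln t)))
  +i*
  (Rintegral lebesgue_measure [set t : R | 0 < t]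
     (fun t => t `^ (complex.Re z - 1) * expR (- t) * sin (complex.Im z * ln t))).

Definition foxH_integrand (alpha gam : R) (x : C) (t : R) : C :=
  let xi := gam +i* t in
  cGamma xi * cGamma (1 - (alpha / 2)%:C * xi) * cpow x (- xi).

(** Fox H-function H_{1,1}^{1,1}(x | (0,alpha/2) ; (0,1)) =
    1/(2 pi i) \int_L Gamma(xi) Gamma(1 - alpha/2 xi) x^(-xi) dxi,
    L = {gam + i t | t in R}; with xi = gam + i t, dxi = i dt, so
    H(x) = 1/(2 pi) \int_R (...) dt.  At x = 0 the value is the
    continuous extension H(0) = 1. *)
Definition foxH (alpha gam : R) (x : C) : C :=
  if x == 0 then 1 else
  ((2 * pi)^-1)%:C *
  ((Rintegral lebesgue_measure setT (fun t => complex.Re (foxH_integrand alpha gam x t)))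
   +i*
   (Rintegral lebesgue_measure setT (fun t => complex.Im (foxH_integrand alpha gam x t)))).

End ComplexFunctions.

Section Probability.
Variables (R : realType) (d : measure_display) (T : measurableType d).
Variable (Pr : probability T R).

Definition mutually_independent (n : nat) (D : 'I_n -> T -> R) : Prop :=
  forall B : 'I_n -> set R, (forall i, measurable (B i)) ->
  Pr (\bigcap_(i in [set: 'I_n]) (D i @^-1` B i)) =
  (\prod_(i < n) Pr (D i @^-1` B i))%E.

Definition has_density (X : T -> R) (f : R -> R) : Prop :=
  forall A : set R, measurable A ->
  (Pr (X @^-1` A) = \int[lebesgue_measure]_(x in A `&` [set x : R | (0 <= x)%R]) (f x)%:E)%E.

(** r-th smallest value (r is 1-indexed) of D_0(w), ..., D_(n-1)(w) *)
Definition order_stat (n : nat) (D : 'I_n -> T -> R) (r : nat) (w : T) : R :=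
  nth 0 (sort <=%O [seq D i w | i <- enum 'I_n]) r.-1.

Definition cexpect (g : T -> R[i]) : R[i] :=
  Rintegral Pr setT (fun w => complex.Re (g w)) +i*
  Rintegral Pr setT (fun w => complex.Im (g w)).

End Probability.

Definition fd (R : realType) (c lamb : R) (x : R) : R :=
  2 * c * lamb * pi * x * expR (- (c * lamb * pi * x ^+ 2)).

(** phi(s) with a = sigma~^2 / P *)
Definition phi (R : realType) (d : measure_display) (T : measurableType d)
  (Pr : probability T R) (n : nat) (D : 'I_n -> T -> R) (r : nat)
  (alpha lamb omega a : R) (s : R[i]) : R[i] :=
  cexpect Pr (fun w =>
    let x := order_stat D r w in
    cexp (- (a%:C * s * (x `^ alpha)%:C)
          - (pi * lamb * omega * x ^+ 2)%:C * cpow s (2 / alpha)%:C)).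

Definition cNOMA (R : realType) : R := 5 / 4.

(* Main.v *)
(** The order statistic [d] has tail [P (d > x) = sum_(j < r) C(n, j) (1 - q)^j q^(n - j)] with
    [n = 2K] and [q = exp (- c lambda pi x^2)]; the derivative in [q] telescopes, which gives the
    density of [d], and expanding it binomially reduces [phi] to the integrals
    [\int_0^oo exp (- b u - a s u^(alpha/2)) du] with [Re b > 0].  All integrals over [(0, oo)] are
    carried to the real line by [u = exp y].
    Such an integral is evaluated by inserting the Mellin inversion formula
    [exp (- z) = (2 pi)^-1 \int Gamma (g + i t) z^(- g - i t) dt], [|arg z| < pi/2], and exchanging
    the integrals; the inner one is then again a Gamma integral, and the Mellin-Barnes integral of
    the Fox function remains.  Mellin inversion is Fourier inversion at [0], proved by Abel
    summation with the Poisson kernel.  Both the formula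
    [\int_0^oo u^(z-1) exp (- b u) du = b^(-z) Gamma z] for complex [b] and the exponential decay of
    [Gamma] on vertical lines come from rotating the ray of integration: the derivative of the
    integral in the angle is the integral of an exact derivative, hence [0]. *)

Require Import Defs.
From HB Require Import structures.
From mathcomp Require Import all_boot all_order all_algebra.
From mathcomp Require Import all_classical all_reals all_analysis.
From mathcomp Require Import measurable_realfun complex ring lra.
Import Order.TTheory GRing.Theory Num.Theory.
Import numFieldNormedType.Exports.
Local Open Scope classical_set_scope.
Local Open Scope ring_scope.
Local Open Scope complex_scope.

Set Implicit Arguments.
Unset Strict Implicit.
Unset Printing Implicit Defensive.

(** The delicate point is the branch of the complex powers. [H] is defined with the principal power
    of [a s b^(-alpha/2)], where [b = pi lambda (m + omega s^(2/alpha))], whereas the exchange of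
    integrals produces [exp (- xi (ln a + Log s - (alpha/2) Log b))]. The two agree once
    [|arg s - (alpha/2) arg b| < pi/2]. Now [arg s = (alpha/2) arg (s^(2/alpha))], and adding
    [m > 0] puts [arg b] between [0] and [arg (s^(2/alpha))], so the difference is at most [|arg s|]
    in modulus. To keep branches under control, bases are written [cexp w] with a chosen logarithm
    [w], and powers become exponentials of linear expressions. The exchange itself rests on the
    modulus of [u^(z-1) exp (- b u)], which depends on [z] only through [Re z]. This is constant on
    a vertical line, so the double integrand has a majorant of product form. The limit in [a] is
    taken in the expectation, where the integrand has modulus at most [1], and not in the
    Mellin-Barnes integral. Its value is the same formula at [a = 0], with [H(0) = 1]. *)

Local Notation nrmc := (@Normc.normc _).
Local Notation leb := lebesgue_measure.

(** * Complex exponential and complex-valued integrals *)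

Lemma complex_eq (R : realType) (z w : R[i]) :
  complex.Re z = complex.Re w -> complex.Im z = complex.Im w -> z = w.
Proof. by case: z w => [a b] [c d] /= -> ->. Qed.

Lemma ReM (R : realType) (z w : R[i]) : complex.Re (z * w) =
  complex.Re z * complex.Re w - complex.Im z * complex.Im w.
Proof. by case: z w => [a b] [c d]. Qed.

Lemma ImM (R : realType) (z w : R[i]) : complex.Im (z * w) =
  complex.Re z * complex.Im w + complex.Im z * complex.Re w.
Proof. by case: z w => [a b] [c d]. Qed.

Lemma ReD (R : realType) (z w : R[i]) :
  complex.Re (z + w) = complex.Re z + complex.Re w.
Proof. by case: z w => [a b] [c d]. Qed.

Lemma ImD (R : realType) (z w : R[i]) :
  complex.Im (z + w) = complex.Im z + complex.Im w.
Proof. by case: z w => [a b] [c d]. Qed.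

Lemma ReN (R : realType) (z : R[i]) : complex.Re (- z) = - complex.Re z.
Proof. by case: z. Qed.

Lemma ImN (R : realType) (z : R[i]) : complex.Im (- z) = - complex.Im z.
Proof. by case: z. Qed.

Lemma Re_mulr_real (R : realType) (z : R[i]) (x : R) :
  complex.Re (z * x%:C) = complex.Re z * x.
Proof. by rewrite ReM /= mulr0 subr0. Qed.

Lemma Im_mulr_real (R : realType) (z : R[i]) (x : R) :
  complex.Im (z * x%:C) = complex.Im z * x.
Proof. by rewrite ImM /= mulr0 add0r. Qed.

Lemma normc_sqrtE (R : realType) (z : R[i]) :
  nrmc z = Num.sqrt (complex.Re z ^+ 2 + complex.Im z ^+ 2).
Proof. by case: z. Qed.

Lemma normc_ge0 (R : realType) (z : R[i]) : 0 <= nrmc z.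
Proof. by rewrite normc_sqrtE sqrtr_ge0. Qed.

Lemma normr_Re_le (R : realType) (z : R[i]) : `|complex.Re z| <= nrmc z.
Proof. by rewrite normc_sqrtE -sqrtr_sqr ler_wsqrtr// lerDl sqr_ge0. Qed.

Lemma normr_Im_le (R : realType) (z : R[i]) : `|complex.Im z| <= nrmc z.
Proof. by rewrite normc_sqrtE -sqrtr_sqr ler_wsqrtr// lerDr sqr_ge0. Qed.

Lemma normc_le_ReIm (R : realType) (z : R[i]) :
  nrmc z <= `|complex.Re z| + `|complex.Im z|.
Proof.
rewrite normc_sqrtE -[leRHS]ger0_norm ?addr_ge0// -sqrtr_sqr ler_wsqrtr//.
by rewrite sqrrD !real_normK ?num_real// lerD2r lerDl mulrn_wge0 ?mulr_ge0.
Qed.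

Lemma Re_cexp (R : realType) (z : R[i]) :
  complex.Re (cexp z) = expR (complex.Re z) * cos (complex.Im z).
Proof. by rewrite /cexp ReM /= mul0r subr0. Qed.

Lemma Im_cexp (R : realType) (z : R[i]) :
  complex.Im (cexp z) = expR (complex.Re z) * sin (complex.Im z).
Proof. by rewrite /cexp ImM /= mul0r addr0. Qed.

#[local] Opaque cexp.

Lemma cexpD (R : realType) (z w : R[i]) : cexp (z + w) = cexp z * cexp w.
Proof.
apply: complex_eq.
  by rewrite Re_cexp ReD ImD expRD cosD ReM !Re_cexp !Im_cexp; ring.
by rewrite Im_cexp ReD ImD expRD sinD ImM !Re_cexp !Im_cexp; ring.
Qed.

Lemma normc_cexp (R : realType) (z : R[i]) : nrmc (cexp z) = expR (complex.Re z).
Proof.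
rewrite normc_sqrtE Re_cexp Im_cexp !exprMn -mulrDr cos2Dsin2 mulr1 sqrtr_sqr.
by rewrite ger0_norm ?expR_ge0.
Qed.

Lemma cexp_real (R : realType) (x : R) : cexp x%:C = (expR x)%:C.
Proof.
by apply: complex_eq; rewrite ?Re_cexp ?Im_cexp/= ?cos0 ?sin0 ?mulr1 ?mulr0.
Qed.

Lemma cexp0 (R : realType) : cexp (0 : R[i]) = 1.
Proof. by rewrite -[0]/(0%:C) cexp_real expR0. Qed.

Lemma cexpNK (R : realType) (z : R[i]) : cexp (- z) * cexp z = 1.
Proof. by rewrite -cexpD addNr cexp0. Qed.

Lemma cexp_neq0 (R : realType) (z : R[i]) : cexp z != 0.
Proof.
apply/eqP => z0; have := cexpNK z; rewrite z0 mulr0 => /eqP.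
by rewrite eq_sym oner_eq0.
Qed.

Lemma cexpN (R : realType) (z : R[i]) : cexp (- z) = (cexp z)^-1.
Proof. by rewrite -[LHS](mulfK (cexp_neq0 z)) cexpNK mul1r. Qed.

Section ComplexIntegral.
Context (R : realType) (d : measure_display) (T : measurableType d).

Definition Cmeasurable (f : T -> R[i]) :=
  measurable_fun setT (fun x => complex.Re (f x)) /\
  measurable_fun setT (fun x => complex.Im (f x)).

Lemma Cmeasurable_real (f : T -> R) :
  measurable_fun setT f -> Cmeasurable (fun x => (f x)%:C).
Proof. by move=> mf; split => //=; exact: measurable_cst. Qed.

Lemma Cmeasurable_cst (c : R[i]) : Cmeasurable (fun=> c).
Proof. by split; exact: measurable_cst. Qed.

Lemma CmeasurableD (f g : T -> R[i]) :
  Cmeasurable f -> Cmeasurable g -> Cmeasurable (fun x => f x + g x).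
Proof.
move=> [f1 f2] [g1 g2]; split.
- by under eq_fun do rewrite ReD; exact: measurable_funD.
- by under eq_fun do rewrite ImD; exact: measurable_funD.
Qed.

Lemma CmeasurableN (f : T -> R[i]) :
  Cmeasurable f -> Cmeasurable (fun x => - f x).
Proof.
move=> [f1 f2]; split.
- by under eq_fun do rewrite ReN; exact: measurableT_comp.
- by under eq_fun do rewrite ImN; exact: measurableT_comp.
Qed.

Lemma CmeasurableM (f g : T -> R[i]) :
  Cmeasurable f -> Cmeasurable g -> Cmeasurable (fun x => f x * g x).
Proof.
move=> [f1 f2] [g1 g2]; split.
- under eq_fun do rewrite ReM.
  by apply: measurable_funB; exact: measurable_funM.
- under eq_fun do rewrite ImM.
  by apply: measurable_funD; exact: measurable_funM.
Qed.

Lemma Cmeasurable_cexp (f : T -> R[i]) :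
  Cmeasurable f -> Cmeasurable (fun x => cexp (f x)).
Proof.
move=> [f1 f2]; split.
- under eq_fun do rewrite Re_cexp; apply: measurable_funM.
    exact: measurableT_comp.
  exact: (measurableT_comp (continuous_measurable_fun (@continuous_cos R)) f2).
- under eq_fun do rewrite Im_cexp; apply: measurable_funM.
    exact: measurableT_comp.
  exact: (measurableT_comp (continuous_measurable_fun (@continuous_sin R)) f2).
Qed.

Variable mu : {measure set T -> \bar R}.

Definition Cint (f : T -> R[i]) : R[i] :=
  Rintegral mu setT (fun x => complex.Re (f x)) +i*
  Rintegral mu setT (fun x => complex.Im (f x)).

Definition Cintegrable (f : T -> R[i]) :=
  mu.-integrable setT (EFin \o (fun x => complex.Re (f x))) /\
  mu.-integrable setT (EFin \o (fun x => complex.Im (f x))).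

Lemma le_integrableR (f g : T -> R) : measurable_fun setT f ->
  (forall x, `|f x| <= g x) ->
  mu.-integrable setT (EFin \o g) -> mu.-integrable setT (EFin \o f).
Proof.
move=> mf fg; apply: le_integrable => //; first exact/measurable_EFinP.
by move=> x _ /=; rewrite lee_fin (le_trans (fg x))// ler_norm.
Qed.

Lemma integrableMl (k : R) (f : T -> R) : mu.-integrable setT (EFin \o f) ->
  mu.-integrable setT (EFin \o (fun x => k * f x)).
Proof.
move=> fi; rewrite (_ : _ \o _ = (fun x => k%:E * (EFin \o f) x)%E).
  exact: integrableZl.
by apply/funext => x /=; rewrite EFinM.
Qed.

Lemma le_Cintegrable (f : T -> R[i]) (g : T -> R) : Cmeasurable f ->
  (forall x, nrmc (f x) <= g x) ->
  mu.-integrable setT (EFin \o g) -> Cintegrable f.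
Proof.
move=> [f1 f2] fg ig; split; apply: le_integrableR (ig) => // x.
- exact: le_trans (normr_Re_le _) (fg x).
- exact: le_trans (normr_Im_le _) (fg x).
Qed.

Lemma eq_Cint (f g : T -> R[i]) : f =1 g -> Cint f = Cint g.
Proof. by move=> /funext ->. Qed.

Lemma CintZ (c : R[i]) (f : T -> R[i]) : Cintegrable f ->
  Cint (fun x => c * f x) = c * Cint f.
Proof.
move=> [f1 f2]; apply: complex_eq; rewrite ?ReM ?ImM /=.
- under eq_Rintegral do rewrite ReM.
  by rewrite RintegralB ?RintegralZl//; exact: integrableMl.
- under eq_Rintegral do rewrite ImM.
  by rewrite RintegralD ?RintegralZl//; exact: integrableMl.
Qed.

Lemma CintD (f g : T -> R[i]) : Cintegrable f -> Cintegrable g ->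
  Cint (fun x => f x + g x) = Cint f + Cint g.
Proof.
move=> [f1 f2] [g1 g2]; apply: complex_eq; rewrite ?ReD ?ImD /=.
- by under eq_Rintegral do rewrite ReD; rewrite RintegralD.
- by under eq_Rintegral do rewrite ImD; rewrite RintegralD.
Qed.

Lemma CintegrableD (f g : T -> R[i]) : Cintegrable f -> Cintegrable g ->
  Cintegrable (fun x => f x + g x).
Proof.
move=> [f1 f2] [g1 g2]; split.
- rewrite (_ : _ \o _ = (EFin \o (fun x => complex.Re (f x))) \+
    (EFin \o (fun x => complex.Re (g x))))%E; first exact: integrableD.
  by apply/funext => x /=; rewrite ReD EFinD.
- rewrite (_ : _ \o _ = (EFin \o (fun x => complex.Im (f x))) \+
    (EFin \o (fun x => complex.Im (g x))))%E; first exact: integrableD.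
  by apply/funext => x /=; rewrite ImD EFinD.
Qed.

Lemma Cint0 : Cint (fun=> 0) = 0.
Proof. by apply: complex_eq; rewrite /= /Rintegral integral0. Qed.

Lemma Cintegrable0 : Cintegrable (fun=> 0).
Proof. by split; exact: integrable0. Qed.

Lemma Cint_sum (n : nat) (f : nat -> T -> R[i]) :
  (forall l, Cintegrable (f l)) ->
  Cint (fun x => \sum_(l < n) f l x) = \sum_(l < n) Cint (f l).
Proof.
move=> fi; suff [] : Cintegrable (fun x => \sum_(l < n) f l x) /\
    Cint (fun x => \sum_(l < n) f l x) = \sum_(l < n) Cint (f l) by [].
elim: n => [|n [ih1 ih2]].
  under eq_fun do rewrite big_ord0.
  rewrite big_ord0; split; [exact: Cintegrable0|exact: Cint0].
under eq_fun do rewrite big_ord_recr/=.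
by rewrite big_ord_recr/= CintD// ih2; split => //; exact: CintegrableD.
Qed.

(** The factor 2 comes from bounding real and imaginary parts separately. The bound serves only to
    show that some constant exists, so its size is immaterial. *)
Lemma normc_Cint_le (f : T -> R[i]) (g : T -> R) : Cmeasurable f ->
  (forall x, nrmc (f x) <= g x) -> mu.-integrable setT (EFin \o g) ->
  nrmc (Cint f) <= 2 * Rintegral mu setT g.
Proof.
move=> mf fg ig; have [i1 i2] := le_Cintegrable mf fg ig.
apply: le_trans (normc_le_ReIm _) _; rewrite mulr2n mulrDl !mul1r lerD//=.
- apply: le_trans (le_normr_Rintegral _ _) _ => //; apply: le_Rintegral => //.
    by rewrite (_ : _ \o _ = abse \o (EFin \o (fun x => complex.Re (f x))))//;
      exact: integrable_abse.
  by move=> x _; exact: le_trans (normr_Re_le _) (fg x).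
- apply: le_trans (le_normr_Rintegral _ _) _ => //; apply: le_Rintegral => //.
    by rewrite (_ : _ \o _ = abse \o (EFin \o (fun x => complex.Im (f x))))//;
      exact: integrable_abse.
  by move=> x _; exact: le_trans (normr_Im_le _) (fg x).
Qed.

End ComplexIntegral.

(** * Real integrals *)

Section RealDerivatives.
Context (R : realType).
Implicit Types f g : R -> R.

Lemma is_derive1D f g (x a b : R) : is_derive x 1 f a -> is_derive x 1 g b ->
  is_derive x 1 (fun y => f y + g y) (a + b).
Proof. by move=> *; exact: is_deriveD. Qed.

Lemma is_derive1N f (x a : R) : is_derive x 1 f a ->
  is_derive x 1 (fun y => - f y) (- a).
Proof. by move=> *; exact: is_deriveN. Qed.

Lemma is_derive1M f g (x a b : R) : is_derive x 1 f a -> is_derive x 1 g b ->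
  is_derive x 1 (fun y => f y * g y) (a * g x + f x * b).
Proof.
move=> fa gb; apply: (@is_derive_eq _ _ _ (f * g)).
by rewrite addrC /GRing.scale /= [g x * _]mulrC.
Qed.

Lemma is_derive1Ml (k : R) f (x a : R) : is_derive x 1 f a ->
  is_derive x 1 (fun y => k * f y) (k * a).
Proof. by move=> *; exact: is_deriveZ. Qed.

Lemma is_derive1_expR f (x a : R) : is_derive x 1 f a ->
  is_derive x 1 (fun y => expR (f y)) (a * expR (f x)).
Proof. by move=> fa; rewrite mulrC; exact: is_derive1_comp. Qed.

Lemma is_derive1_cos f (x a : R) : is_derive x 1 f a ->
  is_derive x 1 (fun y => cos (f y)) (- (a * sin (f x))).
Proof. by move=> fa; rewrite mulrC -mulNr; exact: is_derive1_comp. Qed.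

Lemma is_derive1_sin f (x a : R) : is_derive x 1 f a ->
  is_derive x 1 (fun y => sin (f y)) (a * cos (f x)).
Proof. by move=> fa; rewrite mulrC; exact: is_derive1_comp. Qed.

Lemma is_derive1_continuous f (x a : R) : is_derive x 1 f a ->
  {for x, continuous f}.
Proof. by move=> fa; apply/differentiable_continuous/derivable1_diffP. Qed.

Lemma is_derive1_derive1 f (df : R -> R) :
  (forall x : R, is_derive x 1 f (df x)) -> f^`()%classic = df.
Proof.
by move=> fd; apply/funext => x; rewrite derive1E; have [_ ->] := fd x.
Qed.

End RealDerivatives.

Section RealIntegrals.
Context (R : realType).
Implicit Types f g K : R -> R.

Lemma subset_symitv (m n : nat) : (m <= n)%N ->
  (`[- m%:R, m%:R]%classic : set R) `<=` `[- n%:R, n%:R]%classic.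
Proof.
move=> mn x /=; rewrite !in_itv/= => /andP[a b].
by rewrite (le_trans _ a) ?(le_trans b)// ?lerN2 ler_nat.
Qed.

Lemma in_symitv (x : R) (n : nat) : `|x| <= n%:R ->
  x \in (`[- n%:R, n%:R] : interval R).
Proof. by rewrite in_itv/= ler_norml. Qed.

(** The fundamental theorem of calculus evaluates the integral over [[-n, n]], and dominated
    convergence with majorant [|f|] lets [n] grow. *)
Lemma Rintegral_derive0 K f : (forall x : R, is_derive x 1 K (f x)) ->
  continuous f -> leb.-integrable setT (EFin \o f) ->
  K n%:R @[n --> \oo] --> (0 : R) -> K (- n%:R) @[n --> \oo] --> (0 : R) ->
  Rintegral leb setT f = 0.
Proof.
move=> dK cf fi Kp Km.
pose fn (n : nat) (x : R) : \bar R := ((f \_ `[- n%:R, n%:R]) x)%:E.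
(* The index is shifted because [continuous_FTC2] asks for a nondegenerate interval, which excludes
   [n = 0]. *)
have fnE n : (\int[leb]_x fn n.+1 x = (K n.+1%:R - K (- n.+1%:R))%:E)%E.
  have -> : (\int[leb]_x fn n.+1 x =
             \int[leb]_(x in `[(- n.+1%:R)%R, n.+1%:R%R]) (f x)%:E)%E.
    rewrite [RHS]integral_mkcond; apply: eq_integral => x _.
    by rewrite /fn restrict_EFin.
  rewrite EFinB; apply: continuous_FTC2.
  - by rewrite -subr_gt0 opprK addr_gt0.
  - exact: continuous_subspaceT.
  - split.
    + by move=> x _; have [] := dK x.
    + by apply: cvg_at_right_filter; exact: is_derive1_continuous (dK _).
    + by apply: cvg_at_left_filter; exact: is_derive1_continuous (dK _).
  - by move=> x _; rewrite (is_derive1_derive1 dK).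
have mf : measurable_fun setT f by exact: continuous_measurable_fun.
have lim1 : (\int[leb]_x fn n x @[n --> \oo] --> \int[leb]_x (f x)%:E)%E.
  have [] // := @dominated_convergence _ _ R leb setT measurableT fn (EFin \o f)
    (fun x => `|(f x)%:E|%E).
  - move=> n; apply/measurable_EFinP.
    apply/(measurable_restrictT f (measurable_itv `[- n%:R, n%:R])).
    exact: measurable_funTS.
  - exact/measurable_EFinP.
  - apply/aeW => x _; apply: cvg_near_cst; near=> n.
    rewrite /fn patchE ifT// mem_set//=; apply: in_symitv.
    by near: n; exact: nbhs_infty_ger.
  - exact: integrable_abse.
  - apply/aeW => x n _; rewrite /fn patchE; case: ifP => _ //.
    by rewrite /= lee_fin normr0.
have lim2 : (\int[leb]_x fn n x @[n --> \oo] --> 0%E)%E.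
  rewrite -cvg_shiftS; under eq_fun do rewrite fnE.
  apply: cvg_EFin; first exact: nearW.
  rewrite [X in _ --> X](_ : _ = 0 - 0); last by rewrite subr0.
  apply: cvgB; first by rewrite (cvg_shiftS (fun n => K n%:R)).
  by rewrite (cvg_shiftS (fun n => K (- n%:R))).
by rewrite /Rintegral (cvg_unique _ lim1 lim2).
Unshelve. all: by end_near. Qed.

(** Carries a change of variables from nonnegative to signed functions without any integrability
    assumption, the integral being by definition the difference of those of the two parts. *)
Lemma integral_funeposneg (D E : set R) (f g : R -> \bar R) :
  (\int[leb]_(x in D) f^\+ x = \int[leb]_(x in E) g^\+ x)%E ->
  (\int[leb]_(x in D) f^\- x = \int[leb]_(x in E) g^\- x)%E ->
  (\int[leb]_(x in D) f x = \int[leb]_(x in E) g x)%E.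
Proof. by move=> fp fn; rewrite integralE fp fn -integralE. Qed.

(** The compact intervals [[-n, n]] and their images [[exp (- k n), exp (k n)]] exhaust the line and
    the half-line. Substitution holds on each of them, and monotone convergence applies on both
    sides. Continuity is assumed on the open half-line only, since [t^(x-1)] may blow up at [0]. The
    value [k = 1] serves the Gamma integral and [k = 1/2] the distance, whose square is then
    [exp y]. *)
Lemma ge0_integral_expR_subst (k : R) f : 0 < k ->
  (forall x, 0 < x -> {for x, continuous f}) ->
  (forall x, 0 < x -> 0 <= f x) ->
  (\int[leb]_(t in [set t : R | (0 < t)%R]) (f t)%:E =
   \int[leb]_y (f (expR (k * y)) * (k * expR (k * y)))%:E)%E.
Proof.
move=> k0 cf f0.
pose F (y : R) := expR (k * y).
have dF (y : R) : is_derive y 1 F (k * expR (k * y)).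
  apply: is_derive1_expR; rewrite -[X in is_derive _ _ _ X]mulr1.
  exact: is_derive1Ml.
have dFE : F^`()%classic = (fun y => k * expR (k * y)) by exact: is_derive1_derive1.
have ckE : continuous (fun y => k * expR (k * y)).
  move=> y; have dE : is_derive y 1 (fun y => k * expR (k * y)) (k * (k * expR (k * y))).
    exact: is_derive1Ml.
  exact: is_derive1_continuous dE.
pose A (n : nat) : set R := `[F (- n%:R), F n%:R]%classic.
pose B (n : nat) : set R := `[- n%:R, n%:R]%classic.
have F0 y : 0 < F y by exact: expR_gt0.
have leF x y : (F x <= F y) = (x <= y) by rewrite ler_expR ler_pM2l.
have AE : \bigcup_n A n = [set t : R | 0 < t].
  apply/seteqP; split => [x [n _]|x /= x0].
    by rewrite /A /= in_itv/= => /andP[+ _]; exact: lt_le_trans.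
  have [n xn] : exists n : nat, `|ln x / k| <= n%:R.
    by exists (Num.truncn `|ln x / k|).+1; rewrite ltW// truncnS_gt.
  exists n => //; rewrite /A /= in_itv/=.
  have -> : x = F (ln x / k) by rewrite /F mulrC divfK ?gt_eqF// lnK.
  by rewrite !leF -ler_norml.
have BE : \bigcup_n B n = setT.
  apply/seteqP; split => // x _.
  exists (Num.truncn `|x|).+1 => //; apply: in_symitv.
  by rewrite ltW// truncnS_gt.
have ndB : nondecreasing_seq B.
  by move=> m n mn; apply/subsetPset; exact: subset_symitv.
have ndA : nondecreasing_seq A.
  move=> m n mn; apply/subsetPset => x /=; rewrite /A/= !in_itv/= => /andP[a b].
  by rewrite (le_trans _ a) ?(le_trans b)// leF// ?lerN2 ler_nat.
have mg : measurable_fun setT (fun y => f (expR (k * y)) * (k * expR (k * y))).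
  apply: continuous_measurable_fun => y; apply: cvgM; last exact: ckE.
  apply: (@continuous_comp _ _ _ (fun y => expR (k * y)) f).
    exact: is_derive1_continuous (dF y).
  exact/cf/expR_gt0.
have lim1 := @ge0_nondecreasing_set_cvg_integral _ (measurableTypeR R) R A (EFin \o f) leb ndA.
have lim2 := @ge0_nondecreasing_set_cvg_integral _ (measurableTypeR R) R B
  (fun y => (f (expR (k * y)) * (k * expR (k * y)))%:E) leb ndB.
rewrite AE in lim1; rewrite BE in lim2.
have E n : (\int[leb]_(x in A n) (f x)%:E = \int[leb]_(y in B n)
    (f (expR (k * y)) * (k * expR (k * y)))%:E)%E.
  rewrite /A integration_by_substitution_increasing.
  - by rewrite dFE.
  - by rewrite lerNl (le_trans _ (ler0n _ n))// oppr_le0.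
  - by move=> x y _ _ xy; rewrite ltr_expR ltr_pM2l.
  - by rewrite dFE => x _; exact: ckE.
  - by rewrite dFE; apply: cvgP; apply: cvg_at_right_filter; exact: ckE.
  - by rewrite dFE; apply: cvgP; apply: cvg_at_left_filter; exact: ckE.
  - split.
    + by move=> x _; have [] := dF x.
    + by apply: cvg_at_right_filter; exact: is_derive1_continuous (dF _).
    + by apply: cvg_at_left_filter; exact: is_derive1_continuous (dF _).
  - apply: continuous_in_subspaceT => x /set_mem /=.
    by rewrite in_itv/= => /andP[+ _] => /(lt_le_trans (F0 _)); exact: cf.
apply: (cvg_unique _ (lim1 _ _ _)) => //.
- by move=> n; exact: measurable_itv.
- move=> n; apply/measurable_EFinP.
  have mf0 : measurable_fun (`]0, +oo[%classic : set R) f.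
    apply: open_continuous_measurable_fun => //.
    by move=> x /set_mem /=; rewrite in_itv/= andbT; exact: cf.
  apply: measurable_funS mf0; first exact: measurable_itv.
  by move=> x; rewrite /A/= !in_itv/= andbT => /andP[+ _]; exact: lt_le_trans.
- move=> n x; rewrite /A/= in_itv/= lee_fin => /andP[+ _].
  by move=> /(lt_le_trans (F0 _)); exact: f0.
have /funext -> : forall n, (\int[leb]_(x in A n) (EFin \o f) x)%E = (\int[leb]_(y in B n)
    (f (expR (k * y)) * (k * expR (k * y)))%:E)%E by exact: E.
apply: lim2.
- by move=> n; exact: measurable_itv.
- by move=> n; apply/measurable_EFinP; exact: measurable_funTS.
- move=> n x _; rewrite lee_fin mulr_ge0//; first exact/f0/expR_gt0.
  by rewrite mulr_ge0 ?expR_ge0// ltW.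
Qed.

Lemma continuous_maxr0 f (x : R) : {for x, continuous f} ->
  {for x, continuous (fun t => Num.max (f t) 0)}.
Proof. 
move=> fx.
have c0 : {for x, continuous (cst 0 : R -> R)} by exact: cst_continuous.
exact: (@continuous_max R R f (cst 0) x fx c0).
 Qed.

Lemma integral_expR_subst (k : R) f : 0 < k ->
  (forall x, 0 < x -> {for x, continuous f}) ->
  (\int[leb]_(t in [set t : R | (0 < t)%R]) (f t)%:E =
   \int[leb]_y (f (expR (k * y)) * (k * expR (k * y)))%:E)%E.
Proof.
move=> k0 cf.
have ke0 y : 0 <= k * expR (k * y) by rewrite mulr_ge0 ?expR_ge0// ltW.
apply: integral_funeposneg.
- transitivity (\int[leb]_(t in [set t : R | (0 < t)%R]) (Num.max (f t) 0)%:E)%E.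
    by apply: eq_integral => x _; rewrite funeposE -EFin_max.
  rewrite (@ge0_integral_expR_subst k (fun t => Num.max (f t) 0))//.
  + apply: eq_integral => x _; rewrite funeposE -EFin_max; congr (_%:E).
    by rewrite maxr_pMl// mul0r.
  + by move=> x x0; apply: continuous_maxr0; exact: cf.
  + by move=> x _; rewrite le_max lexx orbT.
- transitivity (\int[leb]_(t in [set t : R | (0 < t)%R]) (Num.max (- f t) 0)%:E)%E.
    by apply: eq_integral => x _; rewrite funenegE -EFinN -EFin_max.
  rewrite (@ge0_integral_expR_subst k (fun t => Num.max (- f t) 0))//.
  + apply: eq_integral => x _; rewrite funenegE -EFinN -EFin_max; congr (_%:E).
    by rewrite maxr_pMl// mul0r mulNr.
  + move=> x x0; apply: (@continuous_maxr0 (fun t => - f t)).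
    by apply: cvgN; exact: cf.
  + by move=> x _; rewrite le_max lexx orbT.
Qed.

Lemma integral_scale (k : R) f : 0 < k -> continuous f ->
  (\int[leb]_t (f t)%:E = \int[leb]_y (f (k * y) * k)%:E)%E.
Proof.
move=> k0 cf.
have ge0 g : continuous g -> (forall x, 0 <= g x) ->
    (\int[leb]_t (g t)%:E = \int[leb]_y (g (k * y) * k)%:E)%E.
  move=> cg g0; have dk (y : R) : is_derive y 1 (fun y => k * y) k.
    rewrite -[X in is_derive _ _ _ X]mulr1; exact: is_derive1Ml.
  have dkE : (fun y : R => k * y)^`()%classic = cst k by exact: is_derive1_derive1.
  rewrite (@increasing_ge0_integration_by_substitutionT _ (fun y => k * y) g)//.
  - by rewrite dkE.
  - by move=> x y xy; rewrite ltr_pM2l.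
  - by rewrite dkE; exact: cst_continuous.
  - by rewrite dkE; apply: cvgP; exact: cvg_cst.
  - by rewrite dkE; apply: cvgP; exact: cvg_cst.
  - by apply: gt0_cvgMrNy => //; exact: cvg_id.
  - by apply: gt0_cvgMry => //; exact: cvg_id.
apply: integral_funeposneg.
- transitivity (\int[leb]_t (Num.max (f t) 0)%:E)%E.
    by apply: eq_integral => x _; rewrite funeposE -EFin_max.
  rewrite (ge0 (fun t => Num.max (f t) 0))//.
  + apply: eq_integral => x _; rewrite funeposE -EFin_max; congr (_%:E).
    by rewrite maxr_pMl ?ltW// mul0r.
  + by move=> x; apply: continuous_maxr0; exact: cf.
  + by move=> x; rewrite le_max lexx orbT.
- transitivity (\int[leb]_t (Num.max (- f t) 0)%:E)%E.
    by apply: eq_integral => x _; rewrite funenegE -EFinN -EFin_max.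
  rewrite (ge0 (fun t => Num.max (- f t) 0))//.
  + apply: eq_integral => x _; rewrite funenegE -EFinN -EFin_max; congr (_%:E).
    by rewrite maxr_pMl ?ltW// mul0r mulNr.
  + move=> x; apply: (@continuous_maxr0 (fun t => - f t)).
    by apply: cvgN; exact: cf.
  + by move=> x; rewrite le_max lexx orbT.
Qed.

Lemma integral_opp f : measurable_fun setT f ->
  (\int[leb]_x (f (- x)%R)%:E = \int[leb]_x (f x)%:E)%E.
Proof.
move=> mf.
have ge0 (g : R -> \bar R) : measurable_fun setT g -> (forall x, 0 <= g x)%E ->
    (\int[leb]_t g (- t)%R = \int[leb]_y g y)%E.
  move=> mg g0; transitivity
      (\int[pushforward leb (-%R : R -> measurableTypeR R)]_y g y)%E.
    by rewrite ge0_integral_pushforward.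
  by apply: eq_measure_integral => A mA _; exact: lebesgue_measureN.
apply: integral_funeposneg.
- rewrite -(ge0 ((EFin \o f)^\+)%E)//.
    by apply: eq_integral => x _; rewrite !funeposE.
  exact/measurable_funepos/measurable_EFinP.
- rewrite -(ge0 ((EFin \o f)^\-)%E)//.
    by apply: eq_integral => x _; rewrite !funenegE.
  exact/measurable_funeneg/measurable_EFinP.
Qed.

End RealIntegrals.

(** * Explicit exponential integrals and the decay of the Gamma integrand *)

Section ExponentialIntegrals.
Context (R : realType).

Lemma cvg_expRNM (e : R) : 0 < e -> expR (- (e * x)) @[x --> +oo] --> (0 : R).
Proof.
move=> e0.
apply: (@cvg_comp _ _ _ _ (fun y : R => expR (- y)) _ +oo); last exact: cvgr_expR.
by apply: gt0_cvgMry => //; exact: cvg_id.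
Qed.

(** Adding [1] to the cosine makes the integrand nonnegative, so that the half-line form of the
    fundamental theorem applies without prior integrability. The case [v = 0] then gives the
    integral of the exponential alone, and a subtraction gives that with the cosine alone. *)
Lemma integral_expR_abs_cos (e v : R) : 0 < e ->
  (\int[leb]_t (expR (- (e * `|t|)) * (1 + cos (t * v)))%:E =
   (2 * (e^-1 + e / (e ^+ 2 + v ^+ 2)))%:E)%E.
Proof.
move=> e0.
have ev0 : 0 < e ^+ 2 + v ^+ 2 by rewrite ltr_wpDr ?sqr_ge0// exprn_gt0.
pose f (t : R) := expR (- (e * t)) * (1 + cos (t * v)).
(* The second term is the real part of [exp ((- e + i v) t) / (- e + i v)]. *)
pose F (t : R) := - (e^-1 * expR (- (e * t))) + (e ^+ 2 + v ^+ 2)^-1 *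
  (expR (- (e * t)) * (v * sin (t * v) - e * cos (t * v))).
have dtv (t : R) : is_derive t 1 (fun t => t * v) v.
  have -> : (fun t => t * v) = (fun t => v * t).
    by apply/funext => x; rewrite mulrC.
  by rewrite -[X in is_derive _ _ _ X]mulr1; exact: is_derive1Ml.
have det (t : R) : is_derive t 1 (fun t => expR (- (e * t))) (- e * expR (- (e * t))).
  apply: is_derive1_expR; apply: is_derive1N.
  by rewrite -[X in is_derive _ _ _ X]mulr1; exact: is_derive1Ml.
have dF (t : R) : is_derive t 1 F (f t).
  have -> : f t = - (e^-1 * (- e * expR (- (e * t)))) + (e ^+ 2 + v ^+ 2)^-1 *
    ((- e * expR (- (e * t))) * (v * sin (t * v) - e * cos (t * v)) +
     expR (- (e * t)) * (v * (v * cos (t * v)) - e * - (v * sin (t * v)))).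
    by rewrite /f; field; rewrite !gt_eqF.
  have d1 := is_derive1Ml v (is_derive1_sin (dtv t)).
  have d2 := is_derive1N (is_derive1Ml e (is_derive1_cos (dtv t))).
  have d3 := is_derive1Ml (e ^+ 2 + v ^+ 2)^-1 (is_derive1M (det t) (is_derive1D d1 d2)).
  exact: is_derive1D (is_derive1N (is_derive1Ml e^-1 (det t))) d3.
have f0 t : 0 <= f t by rewrite mulr_ge0 ?expR_ge0// addrC -lerBlDr sub0r cos_geN1.
have cf : continuous f.
  move=> t; apply: cvgM; first exact: is_derive1_continuous (det t).
  apply: cvgD; first exact: cvg_cst.
  by apply: is_derive1_continuous; apply: is_derive1_cos.
have Fy : F x @[x --> +oo] --> (0 : R).
  have lim := cvg_expRNM e0.
  pose M := e^-1 + (e ^+ 2 + v ^+ 2)^-1 * (`|v| + e).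
  apply: (@squeeze_cvgr _ _ _ _ (fun x => - (expR (- (e * x)) * M))
    (fun x => expR (- (e * x)) * M)).
  - near=> x; rewrite -ler_norml /F.
    apply: le_trans (ler_normD _ _) _; rewrite normrN !normrM.
    have ie0 : 0 <= e^-1 by rewrite invr_ge0 ltW.
    have iev0 : 0 <= (e ^+ 2 + v ^+ 2)^-1 by rewrite invr_ge0 ltW.
    rewrite (ger0_norm (expR_ge0 _)) (ger0_norm ie0) (ger0_norm iev0).
    rewrite /M mulrDr [e^-1 * _]mulrC lerD2l mulrCA ler_wpM2l ?expR_ge0//.
    rewrite ler_wpM2l//.
    apply: le_trans (ler_normB _ _) _; rewrite !normrM (ger0_norm (ltW e0)).
    by apply: lerD; rewrite ler_piMr ?normr_ge0 ?(ltW e0)// ler_norml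
      ?sin_le1 ?sin_geN1 ?cos_le1 ?cos_geN1.
  - rewrite -[X in _ --> X]oppr0; apply: cvgN.
    by rewrite -[X in _ --> X](mul0r M); apply: cvgM => //; exact: cvg_cst.
  - by rewrite -[X in _ --> X](mul0r M); apply: cvgM => //; exact: cvg_cst.
rewrite (@ge0_symfun_integralT _ (fun t => expR (- (e * `|t|)) * (1 + cos (t * v)))).
- rewrite -set_itvcy EFinM; congr (_ * _)%E.
  transitivity (\int[leb]_(x in `[0%R, +oo[) (f x)%:E)%E.
    apply: eq_integral => x; rewrite inE/= in_itv/= andbT => x0.
    by rewrite /f ger0_norm.
  rewrite (@ge0_continuous_FTC2y _ _ F _ 0)//.
  + rewrite -EFinB; congr EFin.
    by rewrite /F !(mulr0, mul0r) oppr0 expR0 sin0 cos0; field; rewrite !gt_eqF.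
  + exact: continuous_subspaceT.
  + by apply: cvg_at_right_filter; exact: is_derive1_continuous (dF _).
  + by move=> x _; rewrite (is_derive1_derive1 dF).
- by move=> t; rewrite mulr_ge0 ?expR_ge0// addrC -lerBlDr sub0r cos_geN1.
- move=> t; apply: cvgM; last first.
    apply: cvgD; first exact: cvg_cst.
    by apply: is_derive1_continuous; apply: is_derive1_cos.
  apply: (@continuous_comp _ _ _ (fun t : R => - (e * `|t|)) expR); last exact: continuous_expR.
  apply: cvgN; apply: cvgM; first exact: cvg_cst.
  exact: norm_continuous.
- by move=> t /=; rewrite normrN mulNr cosN.
Unshelve. all: by end_near. Qed.

Lemma measurable_expR_abs (e : R) : measurable_fun setT (fun t : R => expR (- (e * `|t|))).
Proof.
apply: measurableT_comp => //; apply: measurableT_comp => //.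
by apply: measurable_funM => //; exact: measurableT_comp.
Qed.

Lemma integral_expR_abs (e : R) : 0 < e ->
  (\int[leb]_t (expR (- (e * `|t|)))%:E = (2 / e)%:E)%E.
Proof.
move=> e0; have := @integral_expR_abs_cos e 0 e0.
under eq_integral do rewrite mulr0 cos0 mulrC EFinM.
rewrite ge0_integralZl//; last first.
  by apply/measurable_EFinP; exact: measurable_expR_abs.
move=> h.
have -> : (2 / e)%:E = ((2^-1)%:E * (2 * (e^-1 + e / (e ^+ 2 + 0 ^+ 2)))%:E)%E.
  by rewrite -EFinM; congr EFin; field; rewrite !gt_eqF.
rewrite -h muleA -EFinM (_ : 2^-1 * (1 + 1) = 1) ?mul1e//.
by field.
Qed.

Lemma integrable_expR_abs (e : R) : 0 < e ->
  leb.-integrable setT (EFin \o (fun t : R => expR (- (e * `|t|)))).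
Proof.
move=> e0; apply/integrableP; split.
  by apply/measurable_EFinP; exact: measurable_expR_abs.
under eq_integral do rewrite /= ger0_norm ?expR_ge0//.
by rewrite integral_expR_abs// ltry.
Qed.

Lemma Rintegral_expR_abs_cos (e v : R) : 0 < e ->
  Rintegral leb setT (fun t => expR (- (e * `|t|)) * cos (t * v)) =
  2 * e / (e ^+ 2 + v ^+ 2).
Proof.
move=> e0.
have m1 : measurable_fun setT (fun t : R => expR (- (e * `|t|)) * (1 + cos (t * v))).
  apply: measurable_funM; first exact: measurable_expR_abs.
  apply: measurable_funD => //.
  apply: (measurableT_comp (continuous_measurable_fun (@continuous_cos R))).
  exact: measurable_funM.
have i1 : leb.-integrable setT (EFin \o (fun t : R => expR (- (e * `|t|)) * (1 + cos (t * v)))).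
  apply/integrableP; split; first exact/measurable_EFinP.
  have c t : 0 <= 1 + cos (t * v) by rewrite addrC -lerBlDr sub0r cos_geN1.
  under eq_integral do rewrite /= ger0_norm ?mulr_ge0 ?expR_ge0//.
  by rewrite integral_expR_abs_cos// ltry.
transitivity (Rintegral leb setT (fun t : R =>
  expR (- (e * `|t|)) * (1 + cos (t * v)) - expR (- (e * `|t|)))).
  by apply: eq_Rintegral => t _; ring.
rewrite RintegralB ?integrable_expR_abs// /Rintegral integral_expR_abs_cos// integral_expR_abs//=.
have ev0 : 0 < e ^+ 2 + v ^+ 2 by rewrite ltr_wpDr ?sqr_ge0// exprn_gt0.
by field; rewrite !gt_eqF.
Qed.

(** The exponent is that of the Gamma integrand in the variable [y = ln u]. For [y < 0] the linear
    term decays by itself. For [y >= 0], [b exp y] lies above its tangent of slope [x + 1], which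
    leaves [- y] plus a constant; [K] is minus the intercept of that tangent. The rate [min x 1]
    suits both sides. *)
Lemma expR_abs_bound (x b : R) : 0 < x -> 0 < b -> exists C e : R,
  0 < e /\ forall y, x * y - b * expR y <= C - e * `|y|.
Proof.
move=> x0 b0.
have x1 : 0 < x + 1 by rewrite addr_gt0.
pose K := - ((x + 1) * (1 + ln (b / (x + 1)))).
exists (Num.max K 0), (Num.min x 1); split; first by rewrite lt_min x0 ltr01.
move=> y; have [y0|y0] := leP 0 y.
- rewrite ger0_norm//.
  have -> : b * expR y = (x + 1) * expR (y + ln (b / (x + 1))).
    by rewrite expRD lnK ?posrE ?divr_gt0//; field; rewrite gt_eqF.
  have h1 : (x + 1) * (1 + (y + ln (b / (x + 1)))) <= (x + 1) * expR (y + ln (b / (x + 1))).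
    by rewrite ler_wpM2l ?(ltW x1)// expR_ge1Dx.
  have h2 : Num.min x 1 * y <= y by rewrite ler_piMl// ge_min lexx orbT.
  have h3 : K <= Num.max K 0 by rewrite le_max lexx.
  rewrite /K in h3 *; nra.
- rewrite ltr0_norm//.
  have h2 : x * y <= Num.min x 1 * y by rewrite ler_wnM2r ?(ltW y0)// ge_min lexx.
  have h3 : 0 <= Num.max K 0 by rewrite le_max lexx orbT.
  have h4 : 0 <= b * expR y by rewrite mulr_ge0 ?expR_ge0// ltW.
  lra.
Qed.

Lemma measurable_expR_gamma (x b : R) :
  measurable_fun setT (fun y : R => expR (x * y - b * expR y)).
Proof.
apply: measurableT_comp => //; apply: measurable_funB; first exact: measurable_funM.
exact: measurable_funM.
Qed.

Lemma integrable_expR_gamma (x b : R) : 0 < x -> 0 < b ->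
  leb.-integrable setT (EFin \o (fun y : R => expR (x * y - b * expR y))).
Proof.
move=> x0 b0; have [C [e [e0 he]]] := expR_abs_bound x0 b0.
apply: (@le_integrableR R _ (measurableTypeR R) leb _
  (fun y : R => expR C * expR (- (e * `|y|)))).
- exact: measurable_expR_gamma.
- by move=> y; rewrite ger0_norm ?expR_ge0// -expRD ler_expR.
- exact/integrableMl/integrable_expR_abs.
Qed.

End ExponentialIntegrals.

Lemma is_derive1_eq (R : realType) (f : R -> R) (x a b : R) :
  is_derive x 1 f a -> a = b -> is_derive x 1 f b.
Proof. by move=> ? <-. Qed.

(** * The Gamma function and Mellin inversion *)

Section GammaRotation.
Context (R : realType) (x y p th : R).
Hypotheses (x0 : 0 < x) (thb : `|th| < pi / 2).

(* With [z = x + i y] and [w = p + i th], [E1 + i E2] is [z (v + t w) - exp (v + t w)], its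
   derivative in [v] is [A + i B], and its derivative in [t] is [w (A + i B)]; the phase [f]
   of [K] covers both the real part ([f = 0]) and the imaginary part ([f = - pi / 2]). *)

Let E1 (t v : R) := x * (v + t * p) - y * (t * th) - expR (v + t * p) * cos (t * th).
Let E2 (t v : R) := x * (t * th) + y * (v + t * p) - expR (v + t * p) * sin (t * th).
Let A (t v : R) := x - expR (v + t * p) * cos (t * th).
Let B (t v : R) := y - expR (v + t * p) * sin (t * th).
Let K (f t v : R) := expR (E1 t v) * cos (E2 t v + f).
Let dK (f t v : R) :=
  expR (E1 t v) * (A t v * cos (E2 t v + f) - B t v * sin (E2 t v + f)).

Let is_derive_shift (t v : R) : is_derive v 1 (fun v => v + t * p) 1.
Proof.
apply: (is_derive1_eq (is_derive1D (is_derive_id v 1) (is_derive_cst (t * p) v 1))).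
by rewrite addr0.
Qed.

Let is_derive_mulr (a t : R) : is_derive t 1 (fun t => t * a) a.
Proof.
apply: (is_derive1_eq (is_derive1M (is_derive_id t 1) (is_derive_cst a t 1))).
by rewrite mul1r mulr0 addr0.
Qed.

Let is_derive_shiftt (t v : R) : is_derive t 1 (fun t => v + t * p) p.
Proof.
apply: (is_derive1_eq (is_derive1D (is_derive_cst v t 1) (is_derive_mulr p t))).
by rewrite add0r.
Qed.

Let E1v (t v : R) : is_derive v 1 (E1 t) (A t v).
Proof.
have d := is_derive_shift t v.
apply: (is_derive1_eq (is_derive1D (is_derive1D (is_derive1Ml x d)
  (is_derive_cst (- (y * (t * th))) v 1))
  (is_derive1N (is_derive1M (is_derive1_expR d) (is_derive_cst (cos (t * th)) v 1))))).
by rewrite /A /= /cst; ring.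
Qed.

Let E2v (t v : R) : is_derive v 1 (E2 t) (B t v).
Proof.
have d := is_derive_shift t v.
apply: (is_derive1_eq (is_derive1D (is_derive1D (is_derive_cst (x * (t * th)) v 1)
  (is_derive1Ml y d))
  (is_derive1N (is_derive1M (is_derive1_expR d) (is_derive_cst (sin (t * th)) v 1))))).
by rewrite /B /= /cst; ring.
Qed.

Let E1t (t v : R) : is_derive t 1 (fun t => E1 t v) (p * A t v - th * B t v).
Proof.
have d := is_derive_shiftt t v; have d' := is_derive_mulr th t.
apply: (is_derive1_eq (is_derive1D (is_derive1D (is_derive1Ml x d)
  (is_derive1N (is_derive1Ml y d')))
  (is_derive1N (is_derive1M (is_derive1_expR d) (is_derive1_cos d'))))).
by rewrite /A /B; ring.
Qed.

Let E2t (t v : R) : is_derive t 1 (fun t => E2 t v) (p * B t v + th * A t v).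
Proof.
have d := is_derive_shiftt t v; have d' := is_derive_mulr th t.
apply: (is_derive1_eq (is_derive1D (is_derive1D (is_derive1Ml x d')
  (is_derive1Ml y d))
  (is_derive1N (is_derive1M (is_derive1_expR d) (is_derive1_sin d'))))).
by rewrite /A /B; ring.
Qed.

Let Kv (f t v : R) : is_derive v 1 (K f t) (dK f t v).
Proof.
have d := is_derive1D (E2v t v) (is_derive_cst f v 1).
apply: (is_derive1_eq (is_derive1M (is_derive1_expR (E1v t v)) (is_derive1_cos d))).
by rewrite /dK /= /cst; ring.
Qed.

(** Adding [pi / 2] to the phase is multiplication by [i]. The factor [p + i th] of the derivative
    in [t] thus becomes a real combination of two derivatives in [v], at the phases [f] and
    [f + pi / 2]. *)
Let Kt (f t v : R) :
  is_derive t 1 (fun t => K f t v) (p * dK f t v + th * dK (f + pi / 2) t v).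
Proof.
have d := is_derive1D (E2t t v) (is_derive_cst f t 1).
apply: (is_derive1_eq (is_derive1M (is_derive1_expR (E1t t v)) (is_derive1_cos d))).
rewrite /dK /= /cst [E2 t v + (f + _)]addrA sinDpihalf cosDpihalf; ring.
Qed.

Let cexpv (t v : R) : {for v, continuous (fun v => expR (v + t * p))}.
Proof. exact: is_derive1_continuous (is_derive1_expR (is_derive_shift t v)). Qed.

Let dK_continuous (f t : R) : continuous (dK f t).
Proof.
move=> v; have d := is_derive1D (E2v t v) (is_derive_cst f v 1).
apply: cvgM; first exact: is_derive1_continuous (is_derive1_expR (E1v t v)).
apply: cvgB; apply: cvgM.
- by apply: cvgB; [exact: cvg_cst|apply: cvgM; [exact: cexpv|exact: cvg_cst]].
- exact: is_derive1_continuous (is_derive1_cos d).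
- by apply: cvgB; [exact: cvg_cst|apply: cvgM; [exact: cexpv|exact: cvg_cst]].
- exact: is_derive1_continuous (is_derive1_sin d).
Qed.

(** Differentiation under the integral needs an open interval around [[0, 1]]. This margin satisfies
    [(1 + eta) |th| <= th1], where [th1] is midway between [|th|] and [pi / 2], so [cos (t th)]
    stays above [cos th1 > 0] on the whole interval. Also [eta < 1], whence [|t| <= 2], the source
    of the factors 2 in [c0], [M0] and [M1]. *)
Let eta : R := (pi / 2 - `|th|) / pi.

Let eta_gt0 : 0 < eta.
Proof. by rewrite divr_gt0 ?pi_gt0// subr_gt0. Qed.

Let eta_lt1 : eta < 1.
Proof.
have := pi_gt0 R => pi0; rewrite /eta ltr_pdivrMr// mul1r.
by have := normr_ge0 th; lra.
Qed.

Let th1 : R := (`|th| + pi / 2) / 2.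
(** A lower bound for [exp (t p) cos (t th)], uniform in [t]: it keeps the doubly exponential decay
    of the integrand during the rotation. *)
Let c0 : R := expR (- (2 * `|p|)) * cos th1.

Let cos_th1_gt0 : 0 < cos th1.
Proof.
have th0 := normr_ge0 th; have pi0 := pi_gt0 R; have thb' := thb.
by rewrite cos_gt0_pihalf// /th1; apply/andP; split; lra.
Qed.

Let c0_gt0 : 0 < c0.
Proof. by rewrite mulr_gt0 ?expR_gt0 ?cos_th1_gt0. Qed.

Let cos_tth (t : R) : - eta < t < 1 + eta -> cos th1 <= cos (t * th).
Proof.
move=> /andP[t1 t2]; have pi0 := pi_gt0 R; have th0 := normr_ge0 th; have thb' := thb.
have tn : `|t| <= 1 + eta by rewrite ler_norml; apply/andP; split; lra.
have b : `|t * th| <= th1.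
  rewrite normrM; apply: (@le_trans _ _ ((1 + eta) * `|th|)).
    by rewrite ler_wpM2r.
  rewrite mulrDl mul1r.
  have : eta * `|th| <= eta * (pi / 2) by rewrite ler_wpM2l// ltW.
  have -> : eta * (pi / 2) = (pi / 2 - `|th|) / 2 by rewrite /eta mulrA divfK// gt_eqF.
  by rewrite /th1; lra.
rewrite -[cos (t * th)]cos_norm leNgt ltr_cos -?leNgt// in_itv/=; apply/andP; split => //.
- by rewrite /th1; lra.
- by rewrite /th1; lra.
- by apply: le_trans b _; rewrite /th1; lra.
Qed.

Let M0 : R := expR (2 * `|x * p| + 2 * `|y * th|).

Let expR_E1_le (t v : R) : - eta < t < 1 + eta ->
  expR (E1 t v) <= M0 * expR (x * v - c0 * expR v).
Proof.
move=> tI; have ct := cos_tth tI; case/andP: tI => t1 t2.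
have tn : `|t| <= 2 by have e1 := eta_lt1; rewrite ler_norml; apply/andP; split; lra.
rewrite /M0 -expRD ler_expR /E1.
have h1 : t * (x * p) <= 2 * `|x * p|.
  by rewrite (le_trans (ler_norm _))// normrM ler_wpM2r.
have h2 : - (t * (y * th)) <= 2 * `|y * th|.
  by rewrite (le_trans (ler_norm _))// normrN normrM ler_wpM2r.
have h3 : c0 * expR v <= expR (v + t * p) * cos (t * th).
  rewrite expRD mulrC -mulrA ler_wpM2l ?expR_ge0//.
  rewrite /c0; apply: ler_pM; rewrite ?expR_ge0 ?(ltW cos_th1_gt0)// ler_expR lerNl.
  by rewrite (le_trans (ler_norm _))// normrN normrM ler_wpM2r.
by move: h1 h2 h3; nra.
Qed.

Let expR_shift_le (t v : R) : - eta < t < 1 + eta ->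
  expR (v + t * p) <= expR (2 * `|p|) * expR v.
Proof.
move=> /andP[t1 t2].
have tn : `|t| <= 2 by have e1 := eta_lt1; rewrite ler_norml; apply/andP; split; lra.
rewrite -expRD ler_expR addrC lerD2r.
by rewrite (le_trans (ler_norm _))// normrM ler_wpM2r.
Qed.

(** A majorant common to all [t]. The first term bounds [K]; the second absorbs the extra factor
    [exp v] that [A] and [B] bring into the derivatives. *)
Let G (v : R) := expR (x * v - c0 * expR v) + expR ((x + 1) * v - c0 * expR v).

Let K_le (f t v : R) : - eta < t < 1 + eta -> `|K f t v| <= M0 * G v.
Proof.
move=> tI; rewrite normrM (ger0_norm (expR_ge0 _)).
have h : `|cos (E2 t v + f)| <= 1 by rewrite ler_norml cos_geN1 cos_le1.
rewrite (le_trans (ler_piMr (expR_ge0 _) h))// (le_trans (expR_E1_le _ tI))//.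
by rewrite ler_wpM2l ?expR_ge0// lerDl expR_ge0.
Qed.

Let M1 : R := x + `|y| + expR (2 * `|p|).

Let dK_le (f t v : R) : - eta < t < 1 + eta -> `|dK f t v| <= 2 * M0 * M1 * G v.
Proof.
move=> tI; rewrite normrM (ger0_norm (expR_ge0 _)).
have hs := expR_shift_le v tI; have hE := expR_E1_le v tI.
have e0 := expR_ge0 v; have M10 : 0 <= M1 by rewrite !addr_ge0 ?expR_ge0// ltW.
have c1 (a : R) : `|cos a| <= 1 by rewrite ler_norml cos_geN1 cos_le1.
have s1 (a : R) : `|sin a| <= 1 by rewrite ler_norml sin_geN1 sin_le1.
have aux (a b : R) : `|b| <= 1 -> `|a| <= x + `|y| ->
    `|a - expR (v + t * p) * b| <= M1 * (1 + expR v).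
  move=> b1 ax; rewrite (le_trans (ler_normB _ _))// normrM (ger0_norm (expR_ge0 _)).
  have hb : expR (v + t * p) * `|b| <= expR (v + t * p) by rewrite ler_piMr// expR_ge0.
  have y0 := normr_ge0 y; have p0 := expR_ge0 (2 * `|p|).
  have : 0 <= (x + `|y|) * expR v by rewrite mulr_ge0 ?addr_ge0// ltW.
  by rewrite /M1; nra.
have hA : `|A t v| <= M1 * (1 + expR v).
  by apply: aux; rewrite ?c1// ger0_norm ?lerDl// ltW.
have hB : `|B t v| <= M1 * (1 + expR v).
  by apply: aux; rewrite ?s1// lerDr ltW.
have h : `|A t v * cos (E2 t v + f) - B t v * sin (E2 t v + f)| <= 2 * (M1 * (1 + expR v)).
  rewrite (le_trans (ler_normB _ _))// !normrM mulr2n mulrDl mul1r lerD//.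
    by rewrite (le_trans _ hA)// ler_piMr.
  by rewrite (le_trans _ hB)// ler_piMr.
rewrite (le_trans (ler_pM (expR_ge0 _) (normr_ge0 _) hE h))//.
rewrite /G (_ : (x + 1) * v - c0 * expR v = x * v - c0 * expR v + v); last by ring.
rewrite (expRD _ v); set e := expR (x * v - c0 * expR v).
by rewrite (_ : M0 * e * _ = 2 * M0 * M1 * (e + e * expR v))//; ring.
Qed.

Let integrable_G : leb.-integrable setT (EFin \o G).
Proof.
rewrite (_ : EFin \o G = ((EFin \o (fun v : R => expR (x * v - c0 * expR v))) \+
  (EFin \o (fun v : R => expR ((x + 1) * v - c0 * expR v))))%E); last first.
  by apply/funext => v /=; rewrite EFinD.
by apply: integrableD => //; apply: integrable_expR_gamma; rewrite ?addr_gt0 ?c0_gt0.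
Qed.

Let integrable_MG (M : R) : leb.-integrable setT (EFin \o (fun v => M * G v)).
Proof.
exact/integrableMl/integrable_G.
Qed.

(** The sign [(-1) ^+ s] handles both ends of the line at once. *)
Let cvg_MG0 (M : R) (s : bool) : M * G ((-1) ^+ s * n%:R) @[n --> \oo] --> (0 : R).
Proof.
have aux (a : R) : 0 < a ->
    expR (a * ((-1) ^+ s * n%:R) - c0 * expR ((-1) ^+ s * n%:R)) @[n --> \oo] --> (0 : R).
  move=> a0; have [C [e [e0 he]]] := expR_abs_bound a0 c0_gt0.
  apply: (@squeeze_cvgr _ _ _ _ (fun=> 0) (fun n => expR C * expR (- (e * n%:R)))).
  - apply: nearW => n; rewrite expR_ge0/= -expRD ler_expR (le_trans (he _))//.
    by rewrite normrM normrX normrN1 expr1n mul1r ger0_norm.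
  - exact: cvg_cst.
  - rewrite -[X in _ --> X](mulr0 (expR C)); apply: cvgM; first exact: cvg_cst.
    exact: (@cvg_comp _ _ _ (fun n : nat => n%:R : R) (fun y : R => expR (- (e * y))) _
      +oo _ cvgr_idn (cvg_expRNM e0)).
rewrite -[X in _ --> X](mulr0 M); apply: cvgM; first exact: cvg_cst.
rewrite -[X in _ --> X](addr0 0); apply: cvgD; apply: aux => //.
by rewrite addr_gt0.
Qed.

Let K_continuous (f t : R) : continuous (K f t).
Proof. by move=> v; exact: is_derive1_continuous (Kv f t v). Qed.

Let integrable_K (f t : R) : - eta < t < 1 + eta ->
  leb.-integrable setT (EFin \o K f t).
Proof.
move=> tI; apply: (@le_integrableR R _ (measurableTypeR R) leb _ (fun v => M0 * G v)).
- have mK := continuous_measurable_fun (@K_continuous f t); exact: mK.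
- by move=> v; exact: K_le.
- exact: integrable_MG.
Qed.

Let dKt_le (f t v : R) : - eta < t < 1 + eta ->
  `|p * dK f t v + th * dK (f + pi / 2) t v| <= (`|p| + `|th|) * (2 * M0 * M1) * G v.
Proof.
move=> tI; rewrite (le_trans (ler_normD _ _))// [`|p * _|]normrM [`|th * _|]normrM.
rewrite (_ : _ * G v = `|p| * (2 * M0 * M1 * G v) + `|th| * (2 * M0 * M1 * G v)); last by ring.
by rewrite lerD// ler_wpM2l ?normr_ge0// dK_le.
Qed.

Let Rintegral_dKt (f t : R) : - eta < t < 1 + eta ->
  Rintegral leb setT (fun v => p * dK f t v + th * dK (f + pi / 2) t v) = 0.
Proof.
move=> tI.
have cdK : continuous (fun v => p * dK f t v + th * dK (f + pi / 2) t v).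
  move=> v; apply: cvgD; (apply: cvgM; [exact: cvg_cst|exact: dK_continuous]).
have lim (s : bool) :
    p * K f t ((-1) ^+ s * n%:R) + th * K (f + pi / 2) t ((-1) ^+ s * n%:R)
      @[n --> \oo] --> (0 : R).
  apply: (@squeeze_cvgr _ _ _ _ (fun n => - ((`|p| + `|th|) * M0 * G ((-1) ^+ s * n%:R)))
    (fun n => (`|p| + `|th|) * M0 * G ((-1) ^+ s * n%:R))).
  - apply: nearW => n; rewrite -ler_norml (le_trans (ler_normD _ _))//.
    rewrite [`|p * _|]normrM [`|th * _|]normrM.
    rewrite (_ : _ * G _ = `|p| * (M0 * G ((-1) ^+ s * n%:R)) +
      `|th| * (M0 * G ((-1) ^+ s * n%:R))); last by ring.
    by rewrite lerD// ler_wpM2l ?normr_ge0// K_le.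
  - by rewrite -[X in _ --> X]oppr0; apply: cvgN; exact: cvg_MG0.
  - exact: cvg_MG0.
apply: (@Rintegral_derive0 R (fun v => p * K f t v + th * K (f + pi / 2) t v)
  (fun v => p * dK f t v + th * dK (f + pi / 2) t v)).
- by move=> v; exact: is_derive1D (is_derive1Ml p (Kv f t v)) (is_derive1Ml th (Kv _ t v)).
- exact: cdK.
- apply: (@le_integrableR R _ (measurableTypeR R) leb _
    (fun v => (`|p| + `|th|) * (2 * M0 * M1) * G v)).
  + have mK := continuous_measurable_fun cdK; exact: mK.
  + by move=> v; exact: dKt_le.
  + exact: integrable_MG.
- by have := lim false; under eq_fun do rewrite expr0 mul1r.
- by have := lim true; under eq_fun do rewrite expr1 mulN1r.
Qed.

(** In the logarithmic variable, rotating and rescaling the ray is a translation of the real line by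
    [t (p + i th)], with [t] running from [0] to [1]. The integral has derivative [0] in [t], and
    the mean value theorem concludes. *)
Lemma Rintegral_gamma_rotation (f : R) :
  Rintegral leb setT (fun v => expR (E1 1 v) * cos (E2 1 v + f)) =
  Rintegral leb setT (fun v => expR (E1 0 v) * cos (E2 0 v + f)).
Proof.
pose H (t : R) := Rintegral leb setT (K f t).
have dKtE (t v : R) : partial1of2 (K f) t v = p * dK f t v + th * dK (f + pi / 2) t v.
  by rewrite partial1of2E; have [_ ->] := Kt f t v.
have H0 (t : R) : - eta < t < 1 + eta -> is_derive t 1 H 0.
  move=> tI; have It : (`]- eta, 1 + eta[%classic : set R) t by rewrite /= in_itv.
  have iK (s : R) : (`]- eta, 1 + eta[%classic : set R) s ->
      leb.-integrable setT (EFin \o K f s).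
    by rewrite /= in_itv/=; exact: integrable_K.
  have dKs (s v : R) : (`]- eta, 1 + eta[%classic : set R) s -> [set: R] v ->
      derivable (K f ^~ v) s 1.
    by move=> _ _; have [] := Kt f s v.
  have cG0 (v : R) : 0 <= (`|p| + `|th|) * (2 * M0 * M1) * G v.
    have tI0 : - eta < 0 < 1 + eta by have e0 := eta_gt0; apply/andP; split; lra.
    exact: le_trans (normr_ge0 _) (dKt_le f v tI0).
  have dub (s v : R) : (`]- eta, 1 + eta[%classic : set R) s -> [set: R] v ->
      `|partial1of2 (K f) s v| <= (`|p| + `|th|) * (2 * M0 * M1) * G v.
    by rewrite /= in_itv/= => sI _; rewrite dKtE; exact: dKt_le.
  have dH := @derivable_under_integral R _ _ leb (K f) setT measurableT t (- eta) (1 + eta)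
    It iK dKs _ cG0 (integrable_MG _) dub.
  have dHE := @differentiation_under_integral R _ _ leb (K f) setT measurableT t (- eta) (1 + eta)
    It iK dKs _ cG0 (integrable_MG _) dub.
  apply: DeriveDef => //; rewrite -derive1E dHE.
  under eq_Rintegral do rewrite dKtE.
  exact: Rintegral_dKt.
have e0 := eta_gt0.
have [c _] : exists2 c : R, c \in `]0, 1[ & H 1 - H 0 = 0 * (1 - 0).
  apply: (@MVT _ H (fun=> 0)) => //.
  - by move=> t; rewrite in_itv/= => /andP[? ?]; apply: H0; apply/andP; split; lra.
  - apply: continuous_in_subspaceT => t /set_mem/=; rewrite in_itv/= => /andP[? ?].
    by apply: is_derive1_continuous; apply: H0; apply/andP; split; lra.
by rewrite mul0r => /eqP; rewrite subr_eq0 => /eqP.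
Qed.

End GammaRotation.

(** * Dominated convergence and Fubini for real-valued integrals *)

Lemma cvg_Rintegral_dominated (R : realType) (d : measure_display) (T : measurableType d)
    (mu : {measure set T -> \bar R}) (fn : nat -> T -> R) (f g : T -> R) :
  (forall n, measurable_fun setT (fn n)) -> measurable_fun setT f ->
  (forall x, fn n x @[n --> \oo] --> f x) ->
  mu.-integrable setT (EFin \o g) -> (forall n x, `|fn n x| <= g x) ->
  Rintegral mu setT (fn n) @[n --> \oo] --> Rintegral mu setT f.
Proof.
move=> mfn mf fnf ig fng.
have mfn' n : measurable_fun setT (EFin \o fn n) by exact/measurable_EFinP.
have mf' : measurable_fun setT (EFin \o f) by exact/measurable_EFinP.
have cvgE : {ae mu, forall x, [set: T] x -> (EFin \o fn n) x @[n --> \oo] --> (EFin \o f) x}.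
  by apply: aeW => x _; apply: cvg_EFin; [exact: nearW|exact: fnf].
have fgE : {ae mu, forall x n, [set: T] x -> (`|(EFin \o fn n) x| <= (EFin \o g) x)%E}.
  by apply: aeW => x n _; rewrite /= lee_fin.
have [fi _ cvgf] := dominated_convergence measurableT mfn' mf' cvgE ig fgE.
apply: fine_cvg; rewrite fineK; first exact: cvgf.
exact: integrable_fin_num.
Qed.

(** The bound of product form stands for integrability on the plane; each double integral of the
    development has such a majorant. *)
Lemma Rintegral_fubini (R : realType) (f : R -> R -> R) (g h : R -> R) :
  measurable_fun setT (fun z : R * R => f z.1 z.2) ->
  (forall x y, `|f x y| <= g x * h y) ->
  leb.-integrable setT (EFin \o g) -> leb.-integrable setT (EFin \o h) ->
  Rintegral leb setT (fun x => Rintegral leb setT (f x)) =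
  Rintegral leb setT (fun y => Rintegral leb setT (f ^~ y)).
Proof.
move=> mf fgh ig ih.
have i1 x : leb.-integrable setT (EFin \o f x).
  apply: (@le_integrableR R _ (measurableTypeR R) leb _ (fun y => g x * h y)).
  - exact: (measurableT_comp mf (measurable_pair1 x)).
  - exact: fgh.
  - exact: integrableMl.
have i2 y : leb.-integrable setT (EFin \o f ^~ y).
  apply: (@le_integrableR R _ (measurableTypeR R) leb _ (fun x => h y * g x)).
  - exact: (measurableT_comp mf (measurable_pair2 y)).
  - by move=> x; rewrite mulrC; exact: fgh.
  - exact: integrableMl.
have /= fub := @Fubini _ _ (measurableTypeR R) (measurableTypeR R) R leb leb
  (fun z => (f z.1 z.2)%:E).
have fE x : (Rintegral leb setT (f x))%:E = (\int[leb]_y (f x y)%:E)%E.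
  by rewrite /Rintegral fineK//; exact: (integrable_fin_num measurableT (i1 x)).
have fE' y : (Rintegral leb setT (f ^~ y))%:E = (\int[leb]_x (f x y)%:E)%E.
  by rewrite /Rintegral fineK//; exact: (integrable_fin_num measurableT (i2 y)).
congr fine; under eq_integral do rewrite fE.
under [RHS]eq_integral do rewrite fE'.
apply: fub; apply/integrable12ltyP; first exact/measurable_EFinP.
apply: (@le_lt_trans _ _ (\int[leb]_x ((`|g x| * Rintegral leb setT (fun y => `|h y|))%:E))%E).
  apply: ge0_le_integral => //.
  - by move=> x _; exact: integral_ge0.
  - apply: (@measurable_fun_fubini_tonelli_F _ _ (measurableTypeR R) (measurableTypeR R) R leb
      (fun z => `|(f z.1 z.2)%:E|%E)) => //.
    by apply: measurableT_comp => //; exact/measurable_EFinP.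
  - apply/measurable_EFinP; apply: measurable_funM => //.
    apply: measurableT_comp => //.
    by case/integrableP : ig => /measurable_EFinP.
  - move=> x _.
    have ih' : leb.-integrable setT (EFin \o (fun y => `|h y|)) by exact: (integrable_abse ih).
    have -> : (`|g x| * Rintegral leb setT (fun y => `|h y|))%:E =
        (\int[leb]_y (`|g x| * `|h y|)%:E)%E.
      rewrite -RintegralZl// /Rintegral fineK//.
      by apply: integrable_fin_num => //; exact: integrableMl.
    apply: ge0_le_integral => //.
    + apply: measurableT_comp => //; apply/measurable_EFinP.
      exact: (measurableT_comp mf (measurable_pair1 x)).
    + by have /integrableP[] := integrableMl `|g x| ih'.
    + move=> y _; rewrite lee_fin (le_trans (fgh x y))// (le_trans (ler_norm _))//.
      by rewrite normrM.
have ig' : leb.-integrable setT (EFin \o (fun y => `|g y|)) by exact: (integrable_abse ig).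
under eq_integral do rewrite mulrC.
have igh := integrableMl (Rintegral leb setT (fun y => `|h y|)) ig'.
have := integrable_fin_num measurableT igh.
by rewrite fin_numElt => /andP[].
Qed.

(** * Fourier inversion at [0] *)

Section OneDSqr.
Context (R : realType).

Lemma continuous_div_oneDsqr (c : R) : continuous (fun v : R => c / (1 + v ^+ 2)).
Proof.
move=> v; apply: cvgM; first exact: cvg_cst.
apply: cvgV; first by rewrite gt_eqF// ltr_wpDr ?sqr_ge0.
by apply: cvgD; [exact: cvg_cst|exact: exprn_continuous].
Qed.

Lemma integral_div_oneDsqr : (\int[leb]_v (2 / (1 + v ^+ 2))%:E = (2 * pi : R)%:E)%E.
Proof.
have pos (v : R) : 0 < 1 + v ^+ 2 by rewrite ltr_wpDr ?sqr_ge0.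
rewrite (@ge0_symfun_integralT R (fun v => 2 / (1 + v ^+ 2))).
- rewrite -set_itvcy EFinM; congr (_ * _)%E.
  have dF (v : R) : is_derive v 1 (fun v => 2 * atan v) (2 / (1 + v ^+ 2)).
    exact: is_derive1Ml.
  rewrite (@ge0_continuous_FTC2y _ _ (fun v => 2 * atan v) _ pi)//.
  + by rewrite atan0 mulr0 sube0.
  + by move=> x _; rewrite divr_ge0// ltW.
  + exact/continuous_subspaceT/continuous_div_oneDsqr.
  + rewrite [X in _ --> X](_ : pi = 2 * (pi / 2)); last by rewrite mulrC divfK.
    by apply: cvgM; [exact: cvg_cst|exact: cvgy_atan].
  + by apply: cvg_at_right_filter; exact: is_derive1_continuous (dF _).
  + by move=> x _; rewrite (is_derive1_derive1 dF).
- by move=> x; rewrite divr_ge0// ltW.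
- exact: continuous_div_oneDsqr.
- by move=> x /=; rewrite sqrrN.
Qed.

Lemma integrable_div_oneDsqr (c : R) :
  leb.-integrable setT (EFin \o (fun v : R => c * (2 / (1 + v ^+ 2)))).
Proof.
have pos (v : R) : 0 < 1 + v ^+ 2 by rewrite ltr_wpDr ?sqr_ge0.
have i1 : leb.-integrable setT (EFin \o (fun v : R => 2 / (1 + v ^+ 2))).
  apply/integrableP; split.
    have m := continuous_measurable_fun (@continuous_div_oneDsqr 2).
    by apply/measurable_EFinP; exact: m.
  under eq_integral do rewrite /= ger0_norm ?divr_ge0 ?(ltW (pos _))//.
  by rewrite integral_div_oneDsqr ltry.
exact: integrableMl.
Qed.

(* Abel summation: the factor [exp (- e |t|)] turns the double integral into a
   convolution with the Poisson kernel [2 e / (e^2 + v^2)], of mass [2 pi]. *)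
Lemma fourier_cos_inversion (g : R -> R) (B : R) : continuous g ->
  leb.-integrable setT (EFin \o g) -> (forall v, `|g v| <= B) ->
  leb.-integrable setT (EFin \o (fun t => Rintegral leb setT (fun v => g v * cos (t * v)))) ->
  Rintegral leb setT (fun t => Rintegral leb setT (fun v => g v * cos (t * v))) =
  2 * pi * g 0.
Proof.
move=> cg ig gB; set H := fun t => Rintegral leb setT _; move=> iH.
have mH : measurable_fun setT H by case/integrableP : iH => /measurable_EFinP.
pose e (n : nat) : R := n.+1%:R^-1.
have e0 n : 0 < e n by rewrite invr_gt0.
have elim : e n @[n --> \oo] --> (0 : R) by exact: cvg_harmonic.
have mg : measurable_fun setT g by exact: continuous_measurable_fun.
have lim1 : Rintegral leb setT (fun t => expR (- (e n * `|t|)) * H t) @[n --> \oo] -->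
    Rintegral leb setT H.
  apply: (@cvg_Rintegral_dominated R _ (measurableTypeR R) leb _ _ (fun t => `|H t|)).
  - by move=> n; apply: measurable_funM => //; exact: measurable_expR_abs.
  - exact: mH.
  - move=> t; rewrite -[X in _ --> X]mul1r; apply: cvgM; last exact: cvg_cst.
    rewrite -[X in _ --> X]expR0 -[in X in _ --> X]oppr0 -(mul0r `|t|).
    apply: (@cvg_comp _ _ _ (fun n => - (e n * `|t|)) expR); last exact: continuous_expR.
    by apply: cvgN; apply: cvgM => //; exact: cvg_cst.
  - exact: (integrable_abse iH).
  - move=> n t; rewrite normrM ler_piMl// ger0_norm ?expR_ge0//.
    by rewrite -[leRHS]expR0 ler_expR oppr_le0 mulr_ge0// ltW.
(* The factor [exp (- e |t|)] is what makes Fubini applicable, since [g v cos (t v)] alone is not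
   integrable in [t]. *)
have E n : Rintegral leb setT (fun t => expR (- (e n * `|t|)) * H t) =
    Rintegral leb setT (fun v => g (e n * v) * (2 / (1 + v ^+ 2))).
  transitivity (Rintegral leb setT (fun t => Rintegral leb setT
      (fun v => expR (- (e n * `|t|)) * (g v * cos (t * v))))).
    apply: eq_Rintegral => t _; rewrite -RintegralZl//.
    apply: (@le_integrableR R _ (measurableTypeR R) leb _ (fun v => `|g v|)).
    - apply: measurable_funM => //.
      apply: (measurableT_comp (continuous_measurable_fun (@continuous_cos R))).
      exact: measurable_funM.
    - by move=> v; rewrite normrM ler_piMr// ler_norml cos_geN1 cos_le1.
    - exact: (integrable_abse ig).
  rewrite (@Rintegral_fubini R (fun t v => expR (- (e n * `|t|)) * (g v * cos (t * v)))
    (fun t => expR (- (e n * `|t|))) (fun v => `|g v|)); last 4 first.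
  - apply: measurable_funM.
      exact: (measurableT_comp (measurable_expR_abs (e n)) measurable_fst).
    apply: measurable_funM; first exact: (measurableT_comp mg measurable_snd).
    apply: (measurableT_comp (continuous_measurable_fun (@continuous_cos R))).
    by apply: measurable_funM.
  - move=> t v; rewrite !normrM ger0_norm ?expR_ge0// ler_wpM2l ?expR_ge0//.
    by rewrite ler_piMr// ler_norml cos_geN1 cos_le1.
  - exact: integrable_expR_abs.
  - exact: (integrable_abse ig).
  have ev0 v : 0 < e n ^+ 2 + v ^+ 2 by rewrite ltr_wpDr ?sqr_ge0// exprn_gt0.
  have ov0 (v : R) : 0 < 1 + v ^+ 2 by rewrite ltr_wpDr ?sqr_ge0.
  transitivity (Rintegral leb setT (fun v => g v * (2 * e n / (e n ^+ 2 + v ^+ 2)))).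
    apply: eq_Rintegral => v _; rewrite -Rintegral_expR_abs_cos// -RintegralZl//.
      by apply: eq_Rintegral => t _; ring.
    apply: (@le_integrableR R _ (measurableTypeR R) leb _ (fun t => expR (- (e n * `|t|)))).
    - apply: measurable_funM; first exact: measurable_expR_abs.
      apply: (measurableT_comp (continuous_measurable_fun (@continuous_cos R))).
      exact: measurable_funM.
    - move=> t; rewrite normrM ger0_norm ?expR_ge0// ler_piMr ?expR_ge0//.
      by rewrite ler_norml cos_geN1 cos_le1.
    - exact: integrable_expR_abs.
  congr fine.
  (* Scaling by [e n] turns the kernel into the fixed function [2 / (1 + v^2)] and moves [e n] into
     the argument of [g]. The limit then uses only the continuity of [g] at [0] and its bound
     [B]. *)
  rewrite (@integral_scale R (e n) (fun v => g v * (2 * e n / (e n ^+ 2 + v ^+ 2)))) //.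
  - apply: eq_integral => v _; congr EFin.
    have := ev0 (e n * v); have := e0 n; have := ov0 v.
    set k := e n => ov k0 kv; rewrite -!mulrA; congr (_ * _).
    by field; rewrite !gt_eqF.
  - move=> v; apply: cvgM; first exact: cg.
    apply: cvgM; first exact: cvg_cst.
    apply: cvgV; first by rewrite gt_eqF.
    by apply: cvgD; [exact: cvg_cst|exact: exprn_continuous].
have lim2 : Rintegral leb setT (fun t => expR (- (e n * `|t|)) * H t) @[n --> \oo] -->
    Rintegral leb setT (fun v => g 0 * (2 / (1 + v ^+ 2))).
  rewrite (funext E).
  have mk := continuous_measurable_fun (@continuous_div_oneDsqr 2).
  apply: (@cvg_Rintegral_dominated R _ (measurableTypeR R) leb _ _
    (fun v => B * (2 / (1 + v ^+ 2)))).
  - move=> n; apply: measurable_funM; last exact: mk.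
    apply: (measurableT_comp mg); exact: measurable_funM.
  - by apply: measurable_funM => //; exact: mk.
  - move=> v; apply: cvgM; last exact: cvg_cst.
    have ev : e n * v @[n --> \oo] --> (0 : R).
      by rewrite -[X in _ --> X](mul0r v); apply: cvgM => //; exact: cvg_cst.
    exact: (@cvg_comp _ _ _ _ g _ _ _ ev (cg 0)).
  - exact: integrable_div_oneDsqr.
  - move=> n v; have k0 : 0 <= 2 / (1 + v ^+ 2) by rewrite divr_ge0// addr_ge0// sqr_ge0.
    by rewrite normrM (ger0_norm k0) ler_wpM2r.
rewrite (cvg_unique _ lim1 lim2) => //.
have i1 := integrable_div_oneDsqr 1.
rewrite RintegralZl//; last first.
  by move: i1; under eq_fun do rewrite mul1r.
by rewrite /Rintegral integral_div_oneDsqr/= mulrC.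
Qed.

End OneDSqr.

(** * The complex Gamma integral in the logarithmic variable *)

Section ComplexGamma.
Context (R : realType).
Implicit Types (z w b : R[i]) (g t u v : R).

(** The integrand [u^(z-1) exp (- b u) du] after the substitution [u = exp v]. *)
Definition gamma_kernel z b v : R[i] := cexp (z * v%:C - b * (expR v)%:C).

(** Since [Im z] does not occur on the right, every bound derived from this is uniform along
    vertical lines. *)
Lemma normc_gamma_kernel z b v : nrmc (gamma_kernel z b v) =
  expR (complex.Re z * v - complex.Re b * expR v).
Proof. by rewrite normc_cexp ReD ReN !ReM /= !mulr0 !subr0. Qed.

Lemma Cmeasurable_gamma_kernel z b : Cmeasurable (gamma_kernel z b : measurableTypeR R -> R[i]).
Proof.
apply: Cmeasurable_cexp; apply: CmeasurableD.
  by apply: CmeasurableM; [exact: Cmeasurable_cst|exact: Cmeasurable_real].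
apply: CmeasurableN; apply: CmeasurableM; first exact: Cmeasurable_cst.
by apply: Cmeasurable_real; exact: measurable_expR.
Qed.

Lemma Cintegrable_gamma_kernel z b : 0 < complex.Re z -> 0 < complex.Re b ->
  Cintegrable leb (gamma_kernel z b).
Proof.
move=> z0 b0; apply: (@le_Cintegrable R _ (measurableTypeR R) leb _
  (fun v => expR (complex.Re z * v - complex.Re b * expR v))).
- exact: Cmeasurable_gamma_kernel.
- by move=> v; rewrite normc_gamma_kernel.
- exact: integrable_expR_gamma.
Qed.

(** Holds for every [z]: the substitution identifies the two integrals whether or not they converge
    absolutely. *)
Lemma cGammaE z : cGamma z = Cint leb (gamma_kernel z 1).
Proof.
have c (a b' : R) (f : R -> R) : continuous f -> forall t, 0 < t ->
    {for t, continuous (fun t => t `^ a * expR (- t) * f (b' * ln t))}.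
  move=> cf t t0; apply: cvgM; first apply: cvgM.
  - exact: (is_derive1_continuous (is_derive1_powR a t0)).
  - exact: (is_derive1_continuous (is_derive1_expR (is_derive1N (is_derive_id t 1)))).
  - apply: (@continuous_comp _ _ _ (fun t => b' * ln t) f); last exact: cf.
    by apply: cvgM; [exact: cvg_cst|exact: continuous_ln].
have E y : expR y `^ (complex.Re z - 1) * expR (- expR y) * expR y =
    expR (complex.Re z * y - expR y).
  by rewrite -expRM -!expRD; congr expR; ring.
apply: complex_eq; rewrite /cGamma /Cint/=; congr fine.
- rewrite (@integral_expR_subst R 1 (fun t => t `^ (complex.Re z - 1) * expR (- t) *
    cos (complex.Im z * ln t)))//; last exact/c/continuous_cos.
  apply: eq_integral => y _; congr EFin.
  rewrite !mul1r expRK mulrAC E /gamma_kernel Re_cexp mul1r ReD ImD ReN ImN.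
  by rewrite ReM ImM/= !mulr0 subr0 add0r oppr0 addr0.
- rewrite (@integral_expR_subst R 1 (fun t => t `^ (complex.Re z - 1) * expR (- t) *
    sin (complex.Im z * ln t)))//; last exact/c/continuous_sin.
  apply: eq_integral => y _; congr EFin.
  rewrite !mul1r expRK mulrAC E /gamma_kernel Im_cexp mul1r ReD ImD ReN ImN.
  by rewrite ReM ImM/= !mulr0 subr0 add0r oppr0 addr0.
Qed.

#[local] Opaque cGamma.

Lemma Re_cexp_gt0 w : `|complex.Im w| < pi / 2 -> 0 < complex.Re (cexp w).
Proof. by rewrite ltr_norml => h; rewrite Re_cexp mulr_gt0 ?expR_gt0// cos_gt0_pihalf. Qed.

(* Rotating the ray of integration in the Gamma integral. *)
Lemma Cint_gamma_kernel z w : 0 < complex.Re z -> `|complex.Im w| < pi / 2 ->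
  Cint leb (gamma_kernel z (cexp w)) = cexp (- (z * w)) * cGamma z.
Proof.
move=> z0 w0.
have rot := Rintegral_gamma_rotation (complex.Im z) (complex.Re w) z0 w0.
have shift : Cint leb (fun v => cexp (z * (v%:C + w) - cexp (v%:C + w))) = cGamma z.
  rewrite cGammaE; apply: complex_eq => /=.
  - have := rot 0; rewrite !(mul0r, mul1r) => rot0.
    transitivity (Rintegral leb setT (fun v => expR (complex.Re z * (v + complex.Re w) -
      complex.Im z * complex.Im w - expR (v + complex.Re w) * cos (complex.Im w)) *
      cos (complex.Re z * complex.Im w + complex.Im z * (v + complex.Re w) -
      expR (v + complex.Re w) * sin (complex.Im w) + 0))).
      apply: eq_Rintegral => v _; rewrite Re_cexp !ReD !ImD ReN ImN Re_cexp Im_cexp.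
      by rewrite ReM ImM !ReD !ImD/= !add0r addr0.
    under eq_Rintegral do rewrite -[complex.Re w]mul1r -[complex.Im w]mul1r.
    have := rot 0; rewrite /= => ->; apply: eq_Rintegral => v _.
    rewrite /gamma_kernel Re_cexp mul1r ReD ImD ReN ImN ReM ImM/=.
    by rewrite !(mul0r, mulr0, addr0, add0r, subr0, oppr0, cos0, sin0, mulr1).
  - transitivity (Rintegral leb setT (fun v => expR (complex.Re z * (v + complex.Re w) -
      complex.Im z * complex.Im w - expR (v + complex.Re w) * cos (complex.Im w)) *
      cos (complex.Re z * complex.Im w + complex.Im z * (v + complex.Re w) -
      expR (v + complex.Re w) * sin (complex.Im w) - pi / 2))).
      apply: eq_Rintegral => v _; rewrite Im_cexp !ReD !ImD ReN ImN Re_cexp Im_cexp.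
      by rewrite ReM ImM !ReD !ImD/= !add0r cosBpihalf.
    under eq_Rintegral do rewrite -[complex.Re w]mul1r -[complex.Im w]mul1r.
    have := rot (- (pi / 2)); rewrite /= => ->; apply: eq_Rintegral => v _.
    rewrite cosBpihalf /gamma_kernel Im_cexp mul1r ReD ImD ReN ImN ReM ImM/=.
    by rewrite !(mul0r, mulr0, addr0, add0r, subr0, oppr0, cos0, sin0, mulr1).
rewrite -shift.
(* The translated integrand is the kernel with [b = cexp w], up to the constant factor
   [cexp (z w)]. *)
rewrite (_ : (fun v => cexp (z * (v%:C + w) - cexp (v%:C + w))) =
    (fun v => cexp (z * w) * gamma_kernel z (cexp w) v)); last first.
  apply/funext => v; rewrite /gamma_kernel -cexpD; congr cexp.
  by rewrite cexpD cexp_real; ring.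
rewrite CintZ; last exact/Cintegrable_gamma_kernel/Re_cexp_gt0.
by rewrite mulrA cexpNK mul1r.
Qed.

(** Rotating by [w = i u] or [w = - i u], according to the sign of [t], extracts the factor
    [cexp ((g + i t) w)], of modulus [exp (- u |t|)]. The integral that remains is bounded
    independently of [t], as the modulus of its integrand involves only [g] and [cos u]. *)
Lemma normc_cGamma_le g u : 0 < g -> 0 <= u < pi / 2 -> exists M : R,
  forall t, nrmc (cGamma (g +i* t)) <= M * expR (- (u * `|t|)).
Proof.
move=> g0 /andP[u0 u1].
have cu : 0 < cos u by rewrite cos_gt0_pihalf// u1 andbT; lra.
exists (2 * Rintegral leb setT (fun v : R => expR (g * v - cos u * expR v))) => t.
pose w : R[i] := 0 +i* (if 0 <= t then u else - u).
have w0 : `|complex.Im w| < pi / 2 by rewrite /w/=; case: ifP => _; rewrite ?normrN ger0_norm.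
have -> : cGamma (g +i* t) = cexp ((g +i* t) * w) * Cint leb (gamma_kernel (g +i* t) (cexp w)).
  by rewrite Cint_gamma_kernel// mulrA [cexp _ * cexp _]mulrC cexpNK mul1r.
rewrite Normc.normcM normc_cexp mulrC; apply: ler_pM.
- exact: normc_ge0.
- exact: expR_ge0.
- apply: (@normc_Cint_le R _ (measurableTypeR R) leb).
  + exact: Cmeasurable_gamma_kernel.
  + move=> v; rewrite normc_gamma_kernel Re_cexp/= expR0 mul1r.
    by case: ifP => _; rewrite ?cosN.
  + exact: integrable_expR_gamma.
- rewrite ler_expR ReM/= mulr0 sub0r lerN2 mulrC; case: ifP => t0.
    by rewrite ger0_norm.
  by rewrite ltr0_norm ?mulrN ?mulNr// ltNge t0.
Qed.

(** The function is in fact continuous in [t], by continuity under the integral with a majorant that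
    does not depend on [t]. *)
Lemma Cmeasurable_cGamma g : 0 < g ->
  Cmeasurable ((fun t => cGamma (g +i* t)) : measurableTypeR R -> R[i]).
Proof.
move=> g0.
have key (h : R -> R) : continuous h -> (forall x, `|h x| <= 1) ->
    continuous (fun t => Rintegral leb setT (fun v => expR (g * v - expR v) * h (t * v))).
  move=> ch h1 t.
  have tI : t \in (`]t - 1, t + 1[%classic : set R).
    by rewrite inE/= in_itv/= ltrBlDr ltrDl ltr01.
  have mh (s : R) : measurable_fun setT (fun v : R => h (s * v)).
    by apply: (measurableT_comp (continuous_measurable_fun ch)); exact: measurable_funM.
  have bd (s v : R) : `|expR (g * v - expR v) * h (s * v)| <= expR (g * v - 1 * expR v).
    by rewrite normrM mul1r ger0_norm ?expR_ge0// ler_piMr ?expR_ge0.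
  have mf (s : R) : measurable_fun setT (fun v : R => expR (g * v - expR v) * h (s * v)).
    apply: measurable_funM; last exact: mh.
    by have := measurable_expR_gamma g (1 : R); under eq_fun do rewrite mul1r.
  have ig := integrable_expR_gamma g0 (@ltr01 R).
  have chv (v s : R) : {for s, continuous (fun s : R => h (s * v))}.
    apply: (@continuous_comp R R R (fun s : R => s * v) h); last exact: ch.
    by apply: cvgM; [exact: cvg_id|exact: cvg_cst].
  apply: (@continuity_under_integral R _ (measurableTypeR R) leb
    (fun t v => expR (g * v - expR v) * h (t * v)) setT measurableT (t - 1) (t + 1) _ _
    _ ig _ t tI).
  - move=> s _; apply: (@le_integrableR R _ (measurableTypeR R) leb _ _ (mf s) (bd s) ig).
  - apply: aeW => v _ s _; apply: cvgM; first exact: cvg_cst.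
    exact: chv.
  - by move=> s _; apply: aeW => v _; exact: bd.
have c1 x : `|cos x : R| <= 1 by rewrite ler_norml cos_geN1 cos_le1.
have s1 x : `|sin x : R| <= 1 by rewrite ler_norml sin_geN1 sin_le1.
split.
- have m := continuous_measurable_fun (key _ (@continuous_cos R) c1).
  rewrite (_ : (fun t => _) = (fun t => Rintegral leb setT
    (fun v => expR (g * v - expR v) * cos (t * v)))); first exact: m.
  apply/funext => t; rewrite cGammaE/=; apply: eq_Rintegral => v _.
  by rewrite /gamma_kernel Re_cexp mul1r ReD ImD ReN ImN ReM ImM/=
    !(mulr0, subr0, oppr0, addr0, add0r).
- have m := continuous_measurable_fun (key _ (@continuous_sin R) s1).
  rewrite (_ : (fun t => _) = (fun t => Rintegral leb setT
    (fun v => expR (g * v - expR v) * sin (t * v)))); first exact: m.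
  apply/funext => t; rewrite cGammaE/=; apply: eq_Rintegral => v _.
  by rewrite /gamma_kernel Im_cexp mul1r ReD ImD ReN ImN ReM ImM/=
    !(mulr0, subr0, oppr0, addr0, add0r).
Qed.

Lemma Cmeasurable_line g : Cmeasurable ((fun t => g +i* t) : measurableTypeR R -> R[i]).
Proof. by split => /=; [exact: measurable_cst|exact: measurable_id]. Qed.

(** The power grows at most like [exp (|t| |Im w|)], and [Gamma] decays like [exp (- u |t|)] for any
    [u < pi / 2]. Taking [u] midway between [|Im w|] and [pi / 2] leaves a positive rate. *)
Lemma normc_mellin_le g w : 0 < g -> `|complex.Im w| < pi / 2 -> exists M e : R,
  0 < e /\ forall t,
    nrmc (cGamma (g +i* t) * cexp (- ((g +i* t) * w))) <= M * expR (- (e * `|t|)).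
Proof.
move=> g0 w0; pose u : R := (`|complex.Im w| + pi / 2) / 2.
have n0 := normr_ge0 (complex.Im w).
have u0 : 0 <= u < pi / 2 by rewrite /u; apply/andP; split; lra.
have [M hM] := normc_cGamma_le g0 u0.
exists (M * expR (- (g * complex.Re w))), (u - `|complex.Im w|); split.
  by rewrite /u; lra.
move=> t; rewrite Normc.normcM normc_cexp ReN ReM/=.
have -> : M * expR (- (g * complex.Re w)) * expR (- ((u - `|complex.Im w|) * `|t|)) =
  M * expR (- (u * `|t|)) * expR (- (g * complex.Re w) + `|t| * `|complex.Im w|).
  by rewrite -mulrA -expRD -[RHS]mulrA -expRD; congr (_ * expR _); ring.
apply: ler_pM; rewrite ?normc_ge0 ?expR_ge0//.
by rewrite ler_expR opprB addrC lerD2l -normrM ler_norm.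
Qed.

(** By rotation, the integrand is the Fourier transform, at [t], of [v |-> exp (g v - b exp v)] with
    [b = cexp w], whose value at [v = 0] is [exp (- b)]. As this function is complex, its real and
    imaginary parts [g1] and [g2] are inverted separately. The sine integrals that appear are odd in
    [t] and contribute [0]. *)
Lemma mellin_inversion g w : 0 < g -> `|complex.Im w| < pi / 2 ->
  Cint leb (fun t => cGamma (g +i* t) * cexp (- ((g +i* t) * w))) =
  (2 * pi)%:C * cexp (- cexp w).
Proof.
move=> g0 w0; set b := cexp w; have b0 : 0 < complex.Re b by exact: Re_cexp_gt0.
have [M [e [e0 hM]]] := normc_mellin_le g0 w0.
pose h t := cGamma (g +i* t) * cexp (- ((g +i* t) * w)).
have ih : Cintegrable leb h.
  apply: (@le_Cintegrable R _ (measurableTypeR R) leb h (fun t => M * expR (- (e * `|t|)))).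
  - apply: CmeasurableM; first exact: Cmeasurable_cGamma.
    apply: Cmeasurable_cexp; apply: CmeasurableN; apply: CmeasurableM.
      exact: Cmeasurable_line.
    exact: Cmeasurable_cst.
  - exact: hM.
  - exact/integrableMl/integrable_expR_abs.
pose g1 v := complex.Re (gamma_kernel g%:C b v).
pose g2 v := complex.Im (gamma_kernel g%:C b v).
have kE t v : gamma_kernel (g +i* t) b v =
    (g1 v +i* g2 v) * (cos (t * v) +i* sin (t * v)).
  have -> : g1 v +i* g2 v = gamma_kernel g%:C b v by apply: complex_eq.
  have -> : cos (t * v) +i* sin (t * v) = cexp (0 +i* (t * v)).
    by apply: complex_eq; rewrite ?Re_cexp ?Im_cexp/= expR0 mul1r.
  rewrite /gamma_kernel -cexpD; congr cexp.
  by apply: complex_eq; rewrite !(ReD, ImD, ReN, ImN, ReM, ImM)/=; ring.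
have hE t : h t = Cint leb (gamma_kernel (g +i* t) b).
  by rewrite /h Cint_gamma_kernel// mulrC.
have gb v : nrmc (gamma_kernel g%:C b v) <= expR (g * v - complex.Re b * expR v).
  by rewrite normc_gamma_kernel.
have ig := integrable_expR_gamma g0 b0.
have [mg1 mg2] := Cmeasurable_gamma_kernel g%:C b.
have [i1 i2] : Cintegrable leb (gamma_kernel g%:C b) by exact: Cintegrable_gamma_kernel.
have c1 (x : R) : `|cos x| <= 1 by rewrite ler_norml cos_geN1 cos_le1.
have s1 (x : R) : `|sin x| <= 1 by rewrite ler_norml sin_geN1 sin_le1.
have iprod (f k : R -> R) : measurable_fun setT f -> leb.-integrable setT (EFin \o f) ->
   continuous k -> (forall x, `|k x| <= 1) -> forall t,
   leb.-integrable setT (EFin \o (fun v => f v * k (t * v))).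
  move=> mf fi ck k1 t.
  apply: (@le_integrableR R _ (measurableTypeR R) leb _ (fun v => `|f v|)).
  - apply: measurable_funM; first exact: mf.
    have mk := continuous_measurable_fun ck.
    by apply: (measurableT_comp mk); exact: measurable_funM.
  - by move=> v; rewrite normrM ler_piMr.
  - exact: (integrable_abse fi).
pose C (f : R -> R) t := Rintegral leb setT (fun v => f v * cos (t * v)).
pose S (f : R -> R) t := Rintegral leb setT (fun v => f v * sin (t * v)).
have Ceven f t : C f (- t) = C f t.
  by apply: eq_Rintegral => v _; rewrite mulNr cosN.
have Sodd (f : R -> R) t : measurable_fun setT f -> leb.-integrable setT (EFin \o f) ->
    S f (- t) = - S f t.
  move=> mf fi; rewrite /S -[RHS]mulN1r -RintegralZl//;
    last exact: iprod (@continuous_sin R) s1 t.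
  by apply: eq_Rintegral => v _; rewrite mulNr sinN; ring.
have Reh t : complex.Re (h t) = C g1 t - S g2 t.
  rewrite hE/= -RintegralB//; [|exact: iprod (@continuous_cos R) c1 t|
    exact: iprod (@continuous_sin R) s1 t].
  by apply: eq_Rintegral => v _; rewrite kE ReM.
have Imh t : complex.Im (h t) = S g1 t + C g2 t.
  rewrite hE/= -RintegralD//; [|exact: iprod (@continuous_sin R) s1 t|
    exact: iprod (@continuous_cos R) c1 t].
  by apply: eq_Rintegral => v _; rewrite kE ImM.
(* Integrability is known for [H] only. The even part inherits it through
   [A t = (H t + H (- t)) / 2], which also shows that [A] and [H] have the same integral. *)
have split_even (H A B : R -> R) (c : R) : leb.-integrable setT (EFin \o H) ->
    (forall t, H t = A t + B t) -> (forall t, A (- t) = A t) -> (forall t, B (- t) = - B t) ->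
    (leb.-integrable setT (EFin \o A) -> Rintegral leb setT A = c) -> Rintegral leb setT H = c.
  move=> iH HE Ae Bo Ac.
  have mH : measurable_fun setT H by case/integrableP : iH => /measurable_EFinP.
  have mH' : measurable_fun setT (fun t => H (- t)) by exact: measurableT_comp.
  have iH' : leb.-integrable setT (EFin \o (fun t => H (- t))).
    apply/integrableP; split; first by apply/measurable_EFinP; exact: mH'.
    have iaH : leb.-integrable setT (EFin \o (fun t => `|H t|)) by exact: (integrable_abse iH).
    have maH : measurable_fun setT (fun t => `|H t|) by exact: measurableT_comp.
    have aE : (\int[leb]_t (`|H (- t)|)%:E = \int[leb]_t (`|H t|)%:E)%E.
      exact: integral_opp maH.
    rewrite /= aE; have := integrable_fin_num measurableT iaH.
    by rewrite fin_numElt => /andP[].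
  have AE t : A t = 2^-1 * (H t + H (- t)) by rewrite !HE Ae Bo; field.
  have iHH : leb.-integrable setT (EFin \o (fun t => H t + H (- t))).
    rewrite (_ : _ \o _ = (EFin \o H) \+ (EFin \o (fun t => H (- t)%R)))%E.
      exact: integrableD.
    by apply/funext => t /=; rewrite EFinD.
  have iA : leb.-integrable setT (EFin \o A).
    by rewrite (funext AE); exact: integrableMl.
  rewrite -(Ac iA) (funext AE) RintegralZl// RintegralD//.
  rewrite [X in _ + X](_ : _ = Rintegral leb setT H); last by congr fine; exact: integral_opp.
  by field.
have cg1 : continuous g1 /\ continuous g2.
  have d1 v : {for v, continuous (fun v => expR (g * v - complex.Re b * expR v))}.
    apply: (@continuous_comp _ _ _ (fun v => g * v - complex.Re b * expR v) expR);
      last exact: continuous_expR.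
    apply: cvgB; apply: cvgM; try exact: cvg_cst.
    - exact: cvg_id.
    - exact: continuous_expR.
  have d2 v : {for v, continuous (fun v => - (complex.Im b * expR v))}.
    by apply: cvgN; apply: cvgM; [exact: cvg_cst|exact: continuous_expR].
  have dc v : {for v, continuous (fun v => cos (- (complex.Im b * expR v)))}.
    apply: (@continuous_comp R R R (fun v => - (complex.Im b * expR v)) cos v).
      exact: d2.
    exact: continuous_cos.
  have ds v : {for v, continuous (fun v => sin (- (complex.Im b * expR v)))}.
    apply: (@continuous_comp R R R (fun v => - (complex.Im b * expR v)) sin v).
      exact: d2.
    exact: continuous_sin.
  split => v.
  - rewrite (_ : g1 = (fun v => expR (g * v - complex.Re b * expR v) *
      cos (- (complex.Im b * expR v)))); last first.
      apply/funext => x; rewrite /g1 /gamma_kernel Re_cexp ReD ImD ReN ImN !ReM !ImM/=.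
      by rewrite !(mulr0, mul0r, subr0, addr0, add0r).
    by apply: cvgM; [exact: d1|exact: dc].
  - rewrite (_ : g2 = (fun v => expR (g * v - complex.Re b * expR v) *
      sin (- (complex.Im b * expR v)))); last first.
      apply/funext => x; rewrite /g2 /gamma_kernel Im_cexp ReD ImD ReN ImN !ReM !ImM/=.
      by rewrite !(mulr0, mul0r, subr0, addr0, add0r).
    by apply: cvgM; [exact: d1|exact: ds].
case: cg1 => cg1 cg2.
have [K [e' [e'0 hK]]] := expR_abs_bound g0 b0.
have gK v : nrmc (gamma_kernel g%:C b v) <= expR K.
  rewrite normc_gamma_kernel ler_expR (le_trans (hK v))// gerBl.
  by rewrite mulr_ge0// ltW.
have k0 : gamma_kernel g%:C b 0 = cexp (- b).
  by rewrite /gamma_kernel mulr0 add0r expR0 mulr1.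
case: ih => ihR ihI; apply: complex_eq => /=.
- rewrite ReM/= mul0r subr0.
  apply: (split_even _ (C g1) (fun t => - S g2 t) _ ihR).
  + by move=> t; rewrite Reh.
  + exact: Ceven.
  + by move=> t; rewrite Sodd.
  + move=> iC; have gB v : `|g1 v| <= expR K by exact: le_trans (normr_Re_le _) (gK v).
    by have := fourier_cos_inversion cg1 i1 gB iC; rewrite {2}/g1 k0.
- rewrite ImM/= mul0r addr0.
  apply: (split_even _ (C g2) (S g1) _ ihI).
  + by move=> t; rewrite Imh addrC.
  + exact: Ceven.
  + by move=> t; rewrite Sodd.
  + move=> iC; have gB v : `|g2 v| <= expR K by exact: le_trans (normr_Im_le _) (gK v).
    by have := fourier_cos_inversion cg2 i2 gB iC; rewrite {2}/g2 k0.
Qed.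

End ComplexGamma.

(** * The Mellin-Barnes integral *)

Lemma Cint_fubini (R : realType) (f : R -> R -> R[i]) (g h : R -> R) :
  Cmeasurable (fun z : measurableTypeR R * measurableTypeR R => f z.1 z.2) ->
  (forall x y, nrmc (f x y) <= g x * h y) ->
  leb.-integrable setT (EFin \o g) -> leb.-integrable setT (EFin \o h) ->
  Cint leb (fun x => Cint leb (f x)) = Cint leb (fun y => Cint leb (f ^~ y)).
Proof.
move=> [m1 m2] fgh ig ih; apply: complex_eq.
- apply: (@Rintegral_fubini R (fun x y => complex.Re (f x y)) g h) => //.
  by move=> x y; exact: le_trans (normr_Re_le _) (fgh x y).
- apply: (@Rintegral_fubini R (fun x y => complex.Im (f x y)) g h) => //.
  by move=> x y; exact: le_trans (normr_Im_le _) (fgh x y).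
Qed.

Lemma Cmeasurable_comp (R : realType) (d d' : measure_display) (T : measurableType d)
    (U : measurableType d') (f : U -> R[i]) (g : T -> U) :
  measurable_fun setT g -> Cmeasurable f -> Cmeasurable (fun x => f (g x)).
Proof.
move=> mg [f1 f2]; split; first exact: (measurableT_comp f1 mg).
exact: (measurableT_comp f2 mg).
Qed.

(** * The principal logarithm on the right half-plane *)

Section ComplexLog.
Context (R : realType).
Implicit Types z w : R[i].

(** The strip is mapped into [Re > 0], where [carg] is given by its arctangent branch and inverts
    the tangent. *)
Lemma cLog_cexp w : `|complex.Im w| < pi / 2 -> cLog (cexp w) = w.
Proof.
move=> w0; have c0 := Re_cexp_gt0 w0.
apply: complex_eq; rewrite /cLog /=.
- by rewrite -normc_sqrtE normc_cexp expRK.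
- rewrite /carg c0 Re_cexp Im_cexp invfM mulrACA divff ?mul1r ?gt_eqF ?expR_gt0//.
  by rewrite -[_ / _]/(tan _) tanK// in_itv/= -ltr_norml.
Qed.

Lemma Im_cLog_lt z : 0 < complex.Re z -> `|complex.Im (cLog z)| < pi / 2.
Proof. by move=> z0; rewrite /= /carg z0 ltr_norml atan_gtNpi2 atan_ltpi2. Qed.

Lemma cLogK z : 0 < complex.Re z -> cexp (cLog z) = z.
Proof.
move=> z0; set a := complex.Re z; set b := complex.Im z.
have r0 : 0 < Num.sqrt (a ^+ 2 + b ^+ 2) by rewrite sqrtr_gt0 ltr_wpDr ?sqr_ge0// exprn_gt0.
have cE : cos (atan (b / a)) = a / Num.sqrt (a ^+ 2 + b ^+ 2).
  rewrite cos_atan (_ : 1 + (b / a) ^+ 2 = (a ^+ 2 + b ^+ 2) / a ^+ 2).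
    rewrite sqrtrM ?addr_ge0 ?sqr_ge0// sqrtrV ?sqr_ge0// sqrtr_sqr gtr0_norm//.
    by rewrite invfM invrK mulrC.
  by field; rewrite gt_eqF.
have sE : sin (atan (b / a)) = b / Num.sqrt (a ^+ 2 + b ^+ 2).
  have c0 : 0 < cos (atan (b / a)) by rewrite cE divr_gt0.
  have : tan (atan (b / a)) = b / a by rewrite atanK.
  rewrite /tan => /(congr1 (fun x => x * cos (atan (b / a)))).
  rewrite divfK ?gt_eqF// cE => ->.
  by field; rewrite !gt_eqF.
apply: complex_eq.
- by rewrite Re_cexp /= /carg z0 lnK ?posrE// cE mulrC divfK// gt_eqF.
- by rewrite Im_cexp /= /carg z0 lnK ?posrE// sE mulrC divfK// gt_eqF.
Qed.

Lemma cpow_cexp w c : `|complex.Im w| < pi / 2 -> cpow (cexp w) c = cexp (c * w).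
Proof. by move=> w0; rewrite /cpow (negbTE (cexp_neq0 w)) cLog_cexp. Qed.

Lemma cpowE z c : 0 < complex.Re z -> cpow z c = cexp (c * cLog z).
Proof. by move=> z0; rewrite -{1}(cLogK z0) cpow_cexp// Im_cLog_lt. Qed.

End ComplexLog.

#[local] Opaque cLog cpow.

Section MellinBarnes.
Context (R : realType).

(** Mellin inversion is inserted for the factor [exp (- cexp (w1 + k y))]. The integral in [y] that
    is left is a Gamma integral at [z t = 1 - k (g + i t)], whose real part [1 - k g] is positive
    and free of [t]. *)
Lemma mellin_barnes (k g : R) (w1 w2 : R[i]) : 0 < g -> k * g < 1 ->
  `|complex.Im w1| < pi / 2 -> `|complex.Im w2| < pi / 2 ->
  (2 * pi)%:C * Cint leb (fun y : R => cexp (y%:C - cexp w2 * (expR y)%:C -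
                                           cexp w1 * (expR (k * y))%:C)) =
  cexp (- w2) * Cint leb (fun t : R =>
    cGamma (g +i* t) * cGamma (1 - k%:C * (g +i* t)) *
    cexp (- ((g +i* t) * (w1 - k%:C * w2)))).
Proof.
move=> g0 kg w10 w20.
have b10 := Re_cexp_gt0 w10; have b20 := Re_cexp_gt0 w20.
pose z (t : R) : R[i] := 1 - k%:C * (g +i* t).
have Rez t : complex.Re (z t) = 1 - k * g by rewrite /z ReD ReN ReM/=; ring.
have Imz t : complex.Im (z t) = - (k * t) by rewrite /z ImD ImN ImM/=; ring.
have z0 : 0 < 1 - k * g by lra.
have zt0 t : 0 < complex.Re (z t) by rewrite Rez.
have zE t : z t = (1 - k * g) +i* (- k * t).
  by apply: complex_eq; rewrite ?Rez ?Imz//= mulNr.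
pose G1 (t : R) := cGamma (g +i* t) * cexp (- ((g +i* t) * w1)).
have [M [e [e0 hM]]] := normc_mellin_le g0 w10.
have mG1 : Cmeasurable (G1 : measurableTypeR R -> R[i]).
  apply: CmeasurableM; first exact: Cmeasurable_cGamma.
  apply: Cmeasurable_cexp; apply: CmeasurableN; apply: CmeasurableM.
    exact: Cmeasurable_line.
  exact: Cmeasurable_cst.
pose F (y t : R) := G1 t * gamma_kernel (z t) (cexp w2) y.
have ik := integrable_expR_gamma z0 b20.
have ie : leb.-integrable setT (EFin \o (fun t : R => M * expR (- (e * `|t|)))).
  exact/integrableMl/integrable_expR_abs.
have kernel_norm t y : nrmc (gamma_kernel (z t) (cexp w2) y) =
    expR ((1 - k * g) * y - complex.Re (cexp w2) * expR y).
  by rewrite normc_gamma_kernel Rez.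
have mz : Cmeasurable (fun q : measurableTypeR R * measurableTypeR R => z q.2).
  apply: CmeasurableD; first exact: Cmeasurable_cst.
  apply: CmeasurableN; apply: CmeasurableM; first exact: Cmeasurable_cst.
  exact: (Cmeasurable_comp measurable_snd (Cmeasurable_line g)).
have fub : Cint leb (fun y => Cint leb (F y)) = Cint leb (fun t => Cint leb (F ^~ t)).
  (* The modulus of the kernel depends on [y] alone and the bound on [G1] on [t] alone. *)
  apply: (@Cint_fubini R F (fun y => expR ((1 - k * g) * y - complex.Re (cexp w2) * expR y))
    (fun t => M * expR (- (e * `|t|)))) => //.
  - apply: CmeasurableM; first exact: (Cmeasurable_comp measurable_snd mG1).
    apply: Cmeasurable_cexp; apply: CmeasurableD.
      apply: CmeasurableM; first exact: mz.
      by apply: Cmeasurable_real; exact: measurable_fst.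
    apply: CmeasurableN; apply: CmeasurableM; first exact: Cmeasurable_cst.
    by apply: Cmeasurable_real; apply: measurableT_comp => //; exact: measurable_fst.
  - move=> y t; rewrite Normc.normcM kernel_norm mulrC ler_wpM2l ?expR_ge0//.
    exact: hM.
have innert t : Cint leb (F ^~ t) = cexp (- w2) *
    (cGamma (g +i* t) * cGamma (z t) * cexp (- ((g +i* t) * (w1 - k%:C * w2)))).
  rewrite /F CintZ; last exact: Cintegrable_gamma_kernel (zt0 t) b20.
  rewrite (Cint_gamma_kernel (zt0 t) w20) /G1.
  have -> : cexp (- ((g +i* t) * (w1 - k%:C * w2))) =
      cexp w2 * (cexp (- ((g +i* t) * w1)) * cexp (- (z t * w2))).
    by rewrite -!cexpD; congr cexp; rewrite /z; ring.
  rewrite [RHS](_ : _ = (cexp (- w2) * cexp w2) * (cGamma (g +i* t) * cGamma (z t) *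
     (cexp (- ((g +i* t) * w1)) * cexp (- (z t * w2))))); last by ring.
  by rewrite cexpNK mul1r; ring.
have innery y : Cint leb (F y) = (2 * pi)%:C *
    cexp (y%:C - cexp w2 * (expR y)%:C - cexp w1 * (expR (k * y))%:C).
  (* A real translation leaves the imaginary part unchanged, so inversion is available at every
     [y]. *)
  pose w : R[i] := w1 + (k * y)%:C.
  have Imw : complex.Im w = complex.Im w1 by rewrite /w ImD/= addr0.
  have -> : F y = (fun t => cexp (y%:C - cexp w2 * (expR y)%:C) *
      (cGamma (g +i* t) * cexp (- ((g +i* t) * w)))).
    apply/funext => t; rewrite /F /G1 /gamma_kernel.
    rewrite -mulrA -cexpD [RHS]mulrCA -cexpD; congr (_ * cexp _).
    by rewrite /z /w rmorphM/=; ring.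
  have w0 : `|complex.Im w| < pi / 2 by rewrite Imw.
  have [M' [e' [e'0 hM']]] := normc_mellin_le g0 w0.
  rewrite CintZ; last first.
    apply: (@le_Cintegrable R _ (measurableTypeR R) leb _ (fun t => M' * expR (- (e' * `|t|)))).
    - apply: CmeasurableM; first exact: Cmeasurable_cGamma.
      apply: Cmeasurable_cexp; apply: CmeasurableN; apply: CmeasurableM.
        exact: Cmeasurable_line.
      exact: Cmeasurable_cst.
    - exact: hM'.
    - exact/integrableMl/integrable_expR_abs.
  rewrite (mellin_inversion g0 w0) mulrCA -cexpD; congr (_ * cexp _).
  by rewrite /w cexpD cexp_real.
rewrite -CintZ; last first.
  apply: (@le_Cintegrable R _ (measurableTypeR R) leb _
    (fun y => expR (1 * y - complex.Re (cexp w2) * expR y))).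
  - apply: Cmeasurable_cexp; apply: CmeasurableD; first apply: CmeasurableD.
    + exact: Cmeasurable_real.
    + apply: CmeasurableN; apply: CmeasurableM; first exact: Cmeasurable_cst.
      by apply: Cmeasurable_real; exact: measurable_expR.
    + apply: CmeasurableN; apply: CmeasurableM; first exact: Cmeasurable_cst.
      by apply: Cmeasurable_real; apply: measurableT_comp => //; exact: measurable_funM.
  - move=> y; rewrite normc_cexp ler_expR mul1r ReD ReD ReN ReN (ReM (cexp w2)) (ReM (cexp w1)).
    by rewrite [complex.Im _%:C]/= !mulr0 !subr0 gerBl mulr_ge0 ?expR_ge0 ?(ltW b10).
  - by apply: integrable_expR_gamma => //; exact: ltr01.
under [in LHS]eq_fun do rewrite -innery.
rewrite fub (funext innert); apply: CintZ.
pose c := 2 * Rintegral leb setT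
  (fun y : R => expR ((1 - k * g) * y - complex.Re (cexp w2) * expR y)).
apply: (@le_Cintegrable R _ (measurableTypeR R) leb _
  (fun t => (nrmc (cexp w2) * c) * (M * expR (- (e * `|t|))))).
- apply: CmeasurableM; first apply: CmeasurableM.
  + exact: Cmeasurable_cGamma.
  + under eq_fun do rewrite zE.
    apply: (@Cmeasurable_comp R _ _ (measurableTypeR R) (measurableTypeR R)
      (fun t => cGamma ((1 - k * g) +i* t)) (fun t => - k * t)).
      exact: measurable_funM.
    exact: Cmeasurable_cGamma.
  + apply: Cmeasurable_cexp; apply: CmeasurableN; apply: CmeasurableM.
      exact: Cmeasurable_line.
    exact: Cmeasurable_cst.
- move=> t.
  (* Writing [cGamma (z t)] back as a kernel integral bounds it, together with the power of
     [cexp w2], uniformly in [t]. The decay of [G1] then suffices. *)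
  have -> : cGamma (g +i* t) * cGamma (z t) * cexp (- ((g +i* t) * (w1 - k%:C * w2))) =
      (cexp w2 * Cint leb (gamma_kernel (z t) (cexp w2))) * G1 t.
    rewrite (Cint_gamma_kernel (zt0 t) w20) /G1.
    have -> : cexp (- ((g +i* t) * (w1 - k%:C * w2))) =
        cexp w2 * (cexp (- ((g +i* t) * w1)) * cexp (- (z t * w2))).
      by rewrite -!cexpD; congr cexp; rewrite /z; ring.
    by ring.
  rewrite (Normc.normcM _ (G1 t)) (Normc.normcM (cexp w2)); apply: ler_pM.
  + exact: mulr_ge0 (normc_ge0 _) (normc_ge0 _).
  + exact: normc_ge0.
  + apply: ler_wpM2l; first exact: normc_ge0.
    apply: (@normc_Cint_le R _ (measurableTypeR R) leb).
    * exact: Cmeasurable_gamma_kernel.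
    * by move=> y; rewrite kernel_norm.
    * exact: ik.
  + exact: hM.
- exact: integrableMl.
Qed.

Lemma foxH_cexp (alpha gam : R) (w : R[i]) : `|complex.Im w| < pi / 2 ->
  foxH alpha gam (cexp w) = ((2 * pi)^-1)%:C * Cint leb (fun t : R =>
    cGamma (gam +i* t) * cGamma (1 - (alpha / 2)%:C * (gam +i* t)) *
    cexp (- ((gam +i* t) * w))).
Proof.
move=> w0; rewrite /foxH (negbTE (cexp_neq0 w)); congr (_ * _).
by apply: eq_Cint => t; rewrite /foxH_integrand cpow_cexp// mulNr.
Qed.

(** Serves the degenerate case [a = 0], where the Laplace integral is [Gamma 1 / b] and must match
    [H(0) = 1]. *)
Lemma cGamma1 : cGamma (1 : R[i]) = 1.
Proof.
rewrite cGammaE /Cint; apply: complex_eq => /=.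
- transitivity (Rintegral leb setT (fun y : R => expR (- expR (1 * y)) * (1 * expR (1 * y)))).
    apply: eq_Rintegral => y _; rewrite /gamma_kernel !mul1r -rmorphB/= cexp_real/=.
    by rewrite -expRD addrC.
  rewrite /Rintegral -(@integral_expR_subst R 1 (fun t => expR (- t)))//.
    rewrite -set_itvoy integral_itv_obnd_cbnd; last first.
      apply/measurable_EFinP; apply: measurable_funTS.
      by apply: measurableT_comp => //; exact: measurableT_comp.
    have dF (t : R) : is_derive t 1 (fun t => - expR (- t)) (expR (- t)).
      apply: (is_derive1_eq (is_derive1N (is_derive1_expR (is_derive1N (is_derive_id t 1))))).
      by rewrite /= mulN1r opprK.
    have ce : continuous (fun t : R => expR (- t)).
      by move=> t; apply: (@continuous_comp _ _ _ -%R expR); [exact: cvgN|exact: continuous_expR].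
    rewrite (@ge0_continuous_FTC2y _ _ (fun t => - expR (- t)) _ 0)//.
    + by rewrite oppr0 expR0 /= opprK add0r.
    + exact/continuous_subspaceT.
    + by rewrite -[X in _ --> X]oppr0; apply: cvgN; exact: cvgr_expR.
    + by apply: cvg_at_right_filter; exact: is_derive1_continuous (dF _).
    + by move=> x _; rewrite (is_derive1_derive1 dF).
  move=> t _; apply: (@continuous_comp _ _ _ -%R expR); [exact: cvgN|exact: continuous_expR].
- rewrite -[RHS](_ : Rintegral leb setT (fun=> 0) = 0); last by rewrite /Rintegral integral0.
  apply: eq_Rintegral => y _.
  by rewrite /gamma_kernel !mul1r -rmorphB/= cexp_real.
Qed.

(** The last hypothesis places [ln a + Log s - (alpha/2) Log b] in the strip where it is the
    principal logarithm of the argument of [foxH]. The condition [gam < 2 / alpha] is [k g < 1] of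
    [mellin_barnes]. *)
Lemma laplace_foxH (alpha gam a : R) (s b : R[i]) : 2 < alpha -> 0 < gam ->
  gam < 2 / alpha -> 0 <= a -> 0 < complex.Re s -> 0 < complex.Re b ->
  `|complex.Im (cLog s) - alpha / 2 * complex.Im (cLog b)| < pi / 2 ->
  Cint leb (fun y : R => cexp (y%:C - b * (expR y)%:C - a%:C * s * (expR (alpha / 2 * y))%:C)) =
  foxH alpha gam (a%:C * s * cpow b (- (alpha / 2))%:C) / b.
Proof.
move=> a2 g0 ga; rewrite le_eqVlt => /predU1P[<-|a0] s0 b0 sb.
  have key := @Cint_gamma_kernel R 1 (cLog b) ltr01 (Im_cLog_lt b0).
  rewrite !mul0r /foxH eqxx mul1r.
  rewrite cGamma1 mulr1 mul1r cexpN cLogK// in key; rewrite -key.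
  by apply: eq_Cint => y; rewrite /gamma_kernel mul1r mul0r subr0.
have k1 : alpha / 2 * gam < 1.
  rewrite mulrC -ltr_pdivlMr; last by lra.
  by rewrite mul1r invf_div.
pose w1 : R[i] := (ln a)%:C + cLog s.
have Imw1 : complex.Im w1 = complex.Im (cLog s) by rewrite /w1 ImD/= add0r.
have w1E : cexp w1 = a%:C * s by rewrite cexpD cexp_real lnK ?cLogK.
have w10 : `|complex.Im w1| < pi / 2 by rewrite Imw1 Im_cLog_lt.
have := @mellin_barnes (alpha / 2) gam w1 (cLog b) g0 k1 w10 (Im_cLog_lt b0).
rewrite cLogK// w1E cexpN cLogK// => mb.
have xE : a%:C * s * cpow b (- (alpha / 2))%:C = cexp (w1 - (alpha / 2)%:C * cLog b).
  by rewrite cpowE// -w1E -cexpD rmorphN/= mulNr.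
rewrite xE foxH_cexp; last by rewrite ImD ImN ImM/= mul0r addr0 Imw1.
rewrite -mulrA [_ / b]mulrC -mb mulrA -rmorphM/= mulVf ?mul1r//.
by rewrite gt_eqF// mulr_gt0 ?pi_gt0.
Qed.

End MellinBarnes.

(** * Order statistics *)

Section LawFromTails.
Context (R : realType) (d : measure_display) (T : measurableType d).
Variables (P : probability T R) (X : {RV P >-> measurableTypeR R}) (p : R -> R).
Hypotheses (p_ge0 : forall x, 0 <= p x) (mp : measurable_fun setT p).

Let density (A : set (measurableTypeR R)) : \bar R := (\int[leb]_(x in A) (p x)%:E)%E.

Let density0 : density set0 = 0%E.
Proof. by rewrite /density integral_set0. Qed.

Let density_ge0 A : (0 <= density A)%E.
Proof. by apply: integral_ge0 => x _; rewrite lee_fin. Qed.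

Let density_sigma_additive : semi_sigma_additive density.
Proof.
move=> /= F mF tF mUF; rewrite /density; apply: cvg_toP.
  apply: ereal_nondecreasing_is_cvgn => m n mn.
  apply: lee_sum_nneg_natr => // k _ _; apply: integral_ge0 => /= x _.
  by rewrite lee_fin.
rewrite ge0_integral_bigcup//=.
- by apply/measurable_EFinP; exact: measurable_funTS.
- by move=> x _; rewrite lee_fin.
Qed.

#[local] HB.instance Definition _ := isMeasure.Build _ _ _
  density density0 density_ge0 density_sigma_additive.

Hypothesis tails : forall x, (P (X @^-1` `]x, +oo[) = \int[leb]_(y in `]x, +oo[) (p y)%:E)%E.

(** The rays []x, +oo[] generate the Borel sets, are stable under intersection, and cover the line
    with finite mass, so two measures that agree on them are equal. *)
Let law_density A : measurable A -> distribution P X A = density A.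
Proof.
move=> mA.
apply: (@measure_unique _ R (measurableTypeR R) (@RGenOInfty.G R)
  (fun n : nat => `]- n%:R, +oo[%classic)) => //.
- exact: RGenOInfty.measurableE.
- move=> A' B' [x ->] [y ->]; exists (Num.max x y).
  by apply/seteqP; split => z /=; rewrite !in_itv/= !andbT gt_max => /andP.
- by move=> n; exists (- n%:R).
- apply/seteqP; split => // x _; exists (Num.truncn `|x|).+1 => //=.
  rewrite in_itv/= andbT ltrNl (le_lt_trans (ler_norm _))// normrN.
  exact: truncnS_gt.
- by move=> _ [x ->]; exact: tails.
- move=> n; rewrite (le_lt_trans (probability_le1 _ _))// ?ltry//.
Qed.

Let law_dominated : distribution P X `<< (leb : {measure set (measurableTypeR R) -> \bar R}).
Proof.
apply/null_content_dominatesP => A mA A0.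
rewrite law_density// /density null_set_integral//.
by apply: measurable_funTS; exact/measurable_EFinP.
Qed.

(** The Radon-Nikodym derivative of the law has the same integral as [p] over every measurable set,
    hence equals [p] almost everywhere. Boundedness of [h] gives the integrability. *)
Lemma expectation_density (h : R -> R) (B : R) : measurable_fun setT h ->
  (forall x, `|h x| <= B) ->
  (\int[P]_w (h (X w))%:E = \int[leb]_x (h x * p x)%:E)%E.
Proof.
move=> mh hB.
have iX : P.-integrable setT (EFin \o (h \o X)).
  apply: (@le_integrableR _ _ _ _ _ (fun=> B)).
  - have mX := @measurable_funPT _ _ _ _ X; exact: (measurableT_comp mh mX).
  - by move=> w; exact: hB.
  - exact: finite_measure_integrable_cst.
have mEh : measurable_fun setT (EFin \o h) by exact/measurable_EFinP.
rewrite -(@integral_distribution _ _ T (measurableTypeR R) R P X (EFin \o h) mEh iX).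
have ih : (distribution P X).-integrable setT (EFin \o h).
  apply: (@le_integrableR _ _ _ (distribution P X) _ (fun=> B)) => //.
  exact: finite_measure_integrable_cst.
rewrite -(Radon_Nikodym_change_of_variables law_dominated)//=.
apply: ae_eq_integral => //.
- by apply: emeasurable_funM => //; apply: (measurable_int leb); exact: Radon_Nikodym_integrable.
- apply/measurable_EFinP; exact: measurable_funM.
- rewrite [X in ae_eq _ _ _ X](_ : _ = (fun x => (h x)%:E * (p x)%:E)%E); last first.
    by apply/funext => x; rewrite EFinM.
  apply: ae_eqe_mul2l => /=.
  rewrite Radon_NikodymE//=; case: cid => /= f [f1 f2 f3].
  apply: integral_ae_eq => //=.
  + exact/measurable_EFinP.
  + by move=> E _ mE; rewrite -f3//= law_density.
Qed.

End LawFromTails.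

Section OrderStatistics.
Context (R : realType) (d : measure_display) (T : measurableType d).
Variable P : probability T R.

(** If the head exceeds [x], so do all entries and the count is [0]; otherwise the head contributes
    one to the count and the index drops by one. *)
Lemma lt_nth_sorted (s : seq R) (x : R) (k : nat) : sorted <=%O s -> (k < size s)%N ->
  (x < nth 0 s k) = (count (fun y : R => (y <= x)%R) s <= k)%N.
Proof.
elim: s k => // a s ih k /= pas ks.
have sall : all (fun y => a <= y) s by apply: order_path_min pas; exact: le_trans.
have ss := path_sorted pas.
have [ax|xa] := leP a x; last first.
  have -> : count (fun y => y <= x) s = 0%N.
    apply/eqP; rewrite -leqn0 leqNgt -has_count; apply/hasPn => y ys.
    by rewrite -ltNge (lt_le_trans xa)// (allP sall).
  case: k ks => [//|k] /= ks.
  by rewrite (lt_le_trans xa)// (allP sall)// mem_nth.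
case: k ks => [|k] /= ks; first by rewrite ltNge ax.
by rewrite ih// add1n ltnS.
Qed.

Lemma lt_order_stat (n : nat) (D : 'I_n -> T -> R) (r : nat) (w : T) (x : R) :
  (0 < r)%N -> (r <= n)%N ->
  (x < order_stat D r w) = (#|[set i | (D i w <= x)%R]%SET| < r)%N.
Proof.
move=> r0 rn; rewrite /order_stat lt_nth_sorted.
- rewrite (permP (permEl (perm_sort _ _))) count_map.
  rewrite (_ : count _ _ = #|[set i | (D i w <= x)%R]%SET|); first by case: r r0 rn.
  by rewrite -sum1_count -sum1_card big_enum_cond; apply: eq_bigl => i; rewrite inE.
- exact: sort_le_sorted.
- by rewrite size_sort size_map size_enum_ord; case: r r0 rn.
Qed.

Variables (n : nat) (D : 'I_n -> T -> R).
Hypotheses (mD : forall i, measurable_fun setT (D i)) (indep : mutually_independent P D).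

(** The event that [S] is exactly the set of indices with [D i <= x]. It constrains every index, so
    independence applies to it directly, and cells of distinct [S] are disjoint. *)
Let cell (x : R) (S : {set 'I_n}) : set T :=
  \bigcap_(i in [set: 'I_n]) (D i @^-1` (if i \in S then `]-oo, x] else `]x, +oo[)%classic).

Let cellP (x : R) (S : {set 'I_n}) w : cell x S w <-> [set i | (D i w <= x)%R]%SET = S.
Proof.
split=> [cw|<- i _ /=].
- apply/setP => i; rewrite inE; have /= := cw i I.
  by case: ifP => _ /=; rewrite in_itv/= ?andbT => // /lt_geF.
- by rewrite inE; case: leP => h /=; rewrite in_itv/= ?andbT.
Qed.

Let measurable_cell x S : measurable (cell x S).
Proof.
apply: fin_bigcap_measurable => // i _; rewrite -[X in measurable X]setTI.
by apply: mD => //; case: ifP => _; exact: measurable_itv.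
Qed.

Let gt_order_statE (r : nat) (x : R) : (0 < r)%N -> (r <= n)%N ->
  [set w | x < order_stat D r w] =
  \bigcup_(S in [set` enum [pred S : {set 'I_n} | (#|S| < r)%N]]) cell x S.
Proof.
move=> r0 rn; apply/seteqP; split=> w /=.
- rewrite lt_order_stat// => h; exists [set i | (D i w <= x)%R]%SET.
    by rewrite /= mem_enum inE.
  exact/cellP.
- by move=> [S] /=; rewrite mem_enum inE => Sr /cellP SE; rewrite lt_order_stat// SE.
Qed.

Lemma measurable_order_stat (r : nat) : (0 < r)%N -> (r <= n)%N ->
  measurable_fun setT (order_stat D r).
Proof.
move=> r0 rn _; apply: (measurability _ (RGenOInfty.measurableE R)) => //.
move=> _ [_ [x ->] <-]; rewrite setTI.
rewrite (_ : _ @^-1` _ = [set w | x < order_stat D r w]); last first.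
  by apply/seteqP; split => w /=; rewrite in_itv/= andbT.
by rewrite gt_order_statE//; apply: fin_bigcup_measurable => // S _; exact: measurable_cell.
Qed.

Lemma probability_gt_order_stat (r : nat) (x Q : R) : (0 < r)%N -> (r <= n)%N ->
  (forall i, P (D i @^-1` `]x, +oo[) = Q%:E) ->
  P [set w | x < order_stat D r w] =
  (\sum_(j < r) 'C(n, j)%:R * (1 - Q) ^+ j * Q ^+ (n - j))%:E.
Proof.
move=> r0 rn DQ.
have DQ' i : P (D i @^-1` `]-oo, x]) = (1 - Q)%:E.
  have -> : D i @^-1` `]-oo, x] = ~` (D i @^-1` `]x, +oo[).
    by rewrite preimage_setC setCitvr.
  rewrite probability_setC ?DQ//; rewrite -[X in measurable X]setTI.
  by apply: mD => //; exact: measurable_itv.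
have Pcell S : P (cell x S) = ((1 - Q) ^+ #|S| * Q ^+ (n - #|S|))%:E.
  rewrite /cell indep; last by move=> i; case: ifP => _; exact: measurable_itv.
  rewrite (eq_bigr (fun i => (if i \in S then 1 - Q else Q)%:E)); last first.
    by move=> i _; case: ifP => _; rewrite ?DQ ?DQ'.
  rewrite prodEFin; congr EFin.
  rewrite (bigID (mem S))/= (eq_bigr (fun=> 1 - Q)); last by move=> i ->.
  rewrite prodr_const; congr (_ * _).
  rewrite (eq_bigr (fun=> Q)); last by move=> i /negbTE ->.
  rewrite (eq_bigl (mem (~: S))); last by move=> i; rewrite !inE.
  by rewrite prodr_const cardsCs finset.setCK card_ord.
rewrite gt_order_statE// measure_fin_bigcup//; last first.
  by move=> S1 S2 _ _ [w [/cellP <- /cellP <-]].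
rewrite -fsbig_seq ?enum_uniq// big_enum/=.
rewrite (eq_bigr (fun S : {set 'I_n} => ((1 - Q) ^+ #|S| * Q ^+ (n - #|S|))%:E)); last first.
  by move=> S _; exact: Pcell.
rewrite sumEFin; congr EFin.
rewrite (eq_bigl (fun S : {set 'I_n} => (#|S| < r)%N)); last by move=> S; rewrite !inE.
have cardr (S : {set 'I_n}) : (#|S| < n.+1)%N by rewrite ltnS -[leqRHS]card_ord max_card.
(* The probability of a cell depends only on the size of [S]; grouping by size produces the binomial
   coefficients. *)
rewrite (partition_big (fun S : {set 'I_n} => inord #|S| : 'I_n.+1)
  (fun j => (j < r)%N))/=; last first.
  by move=> S Sr; rewrite inordK.
rewrite (big_ord_widen_cond n.+1 xpredT (fun j => 'C(n, j)%:R * (1 - Q) ^+ j * Q ^+ (n - j)))/=;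
  last exact: leqW.
apply: eq_bigr => j jr.
rewrite (eq_bigr (fun=> (1 - Q) ^+ j * Q ^+ (n - j))); last first.
  by move=> S /andP[_ /eqP <-]; rewrite inordK.
rewrite sumr_const -[LHS]mulr_natl -[RHS]mulrA; congr (_ * _); congr (_%:R).
have -> : 'C(n, j) = #|[set A : {set 'I_n} | #|A| == j]%SET| by rewrite card_draws card_ord.
rewrite cardsE; apply: eq_card => S.
rewrite !unfold_in /=; apply/andP/eqnP => [[_ /eqP <-]|Sj]; first by rewrite inordK.
by rewrite Sj jr; split => //; apply/eqP/val_inj; rewrite /= inordK// -Sj.
Qed.

End OrderStatistics.

Section OrderStatisticDensity.
Context (R : realType).

Lemma is_derive1X (f : R -> R) (n : nat) (x a : R) : is_derive x 1 f a ->
  is_derive x 1 (fun y => f y ^+ n) (n%:R * f x ^+ n.-1 * a).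
Proof.
move=> fa; elim: n => [|n ih].
  by rewrite !mul0r; exact: is_derive_cst.
have -> : (fun y => f y ^+ n.+1) = (fun y => f y * f y ^+ n).
  by apply/funext => y; rewrite exprS.
apply: (is_derive1_eq (is_derive1M fa ih)).
case: n {ih} => [|n]; first by rewrite !expr0; ring.
by rewrite /= exprS -[in RHS]natr1; ring.
Qed.

(** The probability of fewer than [r] successes in [n] independent trials, each failing with
    probability [Q]. *)
Definition binomial_tail (n r : nat) (Q : R) : R :=
  \sum_(j < r) 'C(n, j)%:R * (1 - Q) ^+ j * Q ^+ (n - j).

(* The derivatives of the summands telescope. *)
Lemma is_derive_binomial_tail (n r : nat) (Q : R) : (r <= n)%N ->
  is_derive Q 1 (binomial_tail n r)
    (r%:R * 'C(n, r)%:R * (1 - Q) ^+ r.-1 * Q ^+ (n - r)).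
Proof.
elim: r => [|r ih] rn.
  have -> : binomial_tail n 0 = cst 0.
    by apply/funext => q; rewrite /binomial_tail big_ord0.
  by rewrite !mul0r; exact: is_derive_cst.
have -> : binomial_tail n r.+1 =
    (fun q => binomial_tail n r q + 'C(n, r)%:R * ((1 - q) ^+ r * q ^+ (n - r))).
  by apply/funext => q; rewrite /binomial_tail big_ord_recr/= mulrA.
have d1 : is_derive Q 1 (fun q => 1 - q) (-1).
  apply: (is_derive1_eq (is_derive1D (is_derive_cst (1 : R) Q (1 : R))
    (is_derive1N (is_derive_id Q 1)))).
  by rewrite add0r.
apply: (is_derive1_eq (is_derive1D (ih (ltnW rn)) (is_derive1Ml 'C(n, r)%:R
  (is_derive1M (is_derive1X r d1) (is_derive1X (n - r) (is_derive_id Q 1)))))).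
(* Of the two terms in the derivative of the new summand, the one with factor [- r] cancels the
   inductive value; this identity puts the other in the required form. *)
have -> : r.+1%:R * 'C(n, r.+1)%:R = (n - r)%:R * 'C(n, r)%:R :> R.
  by rewrite -!natrM mul_bin_left.
by rewrite subnS /=; ring.
Qed.

(** The maximum occurs because densities live on [[0, +oo[], whereas a law is identified by its
    tails at all real [x]. *)
Lemma integral_tail (f F : R -> R) (x : R) : (forall y, 0 <= y -> 0 <= f y) ->
  continuous f -> (forall y : R, is_derive y 1 F (f y)) -> F y @[y --> +oo] --> (0 : R) ->
  (\int[leb]_(y in `]x, +oo[ `&` [set y : R | (0 <= y)%R]) (f y)%:E =
   (- F (Num.max x 0)%R)%:E)%E.
Proof.
move=> f0 cf dF F0.
have FTC (a : R) : 0 <= a -> (\int[leb]_(y in `[a, +oo[) (f y)%:E = (- F a)%:E)%E.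
  move=> a0; rewrite (@ge0_continuous_FTC2y _ f F _ 0)//.
  - by rewrite sub0e.
  - by move=> y ay; rewrite f0// (le_trans a0).
  - exact: continuous_subspaceT.
  - by apply: cvg_at_right_filter; exact: is_derive1_continuous (dF _).
  - by move=> y _; rewrite (is_derive1_derive1 dF).
have mf : measurable_fun setT f by exact: continuous_measurable_fun.
have [x0|x0] := leP 0 x.
- rewrite (_ : _ `&` _ = `]x, +oo[%classic).
    rewrite integral_itv_obnd_cbnd; first exact: FTC.
    by apply/measurable_EFinP; exact: measurable_funTS.
  apply/seteqP; split => y /=; rewrite in_itv/= andbT; first by case.
  by move=> xy; split => //; rewrite (le_trans x0)// ltW.
- rewrite (_ : _ `&` _ = `[0, +oo[%classic); first exact: FTC.
  apply/seteqP; split => y /=; rewrite !in_itv/= !andbT; first by case.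
  by move=> y0; split => //; rewrite (lt_le_trans x0).
Qed.

Variable k : R.
Hypothesis k_gt0 : 0 < k.

Let q (x : R) := expR (- (k * x ^+ 2)).

Let is_derive_q (x : R) : is_derive x 1 q (- (2 * k * x) * q x).
Proof.
apply: is_derive1_expR.
apply: (is_derive1_eq (is_derive1N (is_derive1Ml k (is_derive1X 2 (is_derive_id x 1))))).
by rewrite /= expr1; ring.
Qed.

Let cvg_q : q x @[x --> +oo] --> (0 : R).
Proof.
apply: (@squeeze_cvgr _ _ _ _ (fun=> 0) (fun x => expR (- (k * x)))).
- near=> x; rewrite expR_ge0/= ler_expR lerN2 ler_wpM2l ?(ltW k_gt0)//.
  by rewrite expr2 ler_peMl//; near: x; apply: nbhs_pinfty_ge; rewrite num_real.
- exact: cvg_cst.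
- exact: cvg_expRNM.
Unshelve. all: by end_near. Qed.

Let q_le1 (x : R) : q x <= 1.
Proof. by rewrite -[leRHS]expR0 ler_expR oppr_le0 mulr_ge0 ?sqr_ge0// ltW// k_gt0. Qed.

Definition rayleigh_density (x : R) : R := 2 * k * x * q x.

Lemma integral_rayleigh_tail (x : R) :
  (\int[leb]_(y in `]x, +oo[ `&` [set y : R | (0 <= y)%R]) (rayleigh_density y)%:E =
   (q (Num.max x 0)%R)%:E)%E.
Proof.
have r0 y : 0 <= y -> 0 <= rayleigh_density y.
  by move=> y0; rewrite /rayleigh_density !mulr_ge0 ?expR_ge0// ltW// k_gt0.
have cr : continuous rayleigh_density.
  move=> y; apply: cvgM; last exact: is_derive1_continuous (is_derive_q y).
  by apply: cvgM; [exact: cvg_cst|exact: cvg_id].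
have dr (y : R) : is_derive y 1 (fun x => - q x) (rayleigh_density y).
  apply: (is_derive1_eq (is_derive1N (is_derive_q y))).
  by rewrite /rayleigh_density; ring.
have qN : - q x @[x --> +oo] --> (0 : R) by rewrite -[X in _ --> X]oppr0; exact: cvgN.
by rewrite (integral_tail x r0 cr dr qN) opprK.
Qed.

(** Minus the derivative of [binomial_tail n r (q x)], by the chain rule, as [rayleigh_density] is
    minus the derivative of [q]. *)
Definition order_stat_density (n r : nat) (x : R) : R :=
  r%:R * 'C(n, r)%:R * (1 - q x) ^+ r.-1 * q x ^+ (n - r) * rayleigh_density x.

Lemma continuous_order_stat_density n r : continuous (order_stat_density n r).
Proof.
move=> x; have cq := is_derive1_continuous (is_derive_q x).
have dq1 : is_derive x 1 (fun x => 1 - q x) (0 + - (- (2 * k * x) * q x)).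
  exact: is_derive1D (is_derive_cst (1 : R) x (1 : R)) (is_derive1N (is_derive_q x)).
apply: cvgM; first apply: cvgM; first apply: cvgM; first exact: cvg_cst.
- exact: is_derive1_continuous (is_derive1X r.-1 dq1).
- exact: is_derive1_continuous (is_derive1X (n - r) (is_derive_q x)).
- apply: cvgM; last exact: cq.
  by apply: cvgM; [exact: cvg_cst|exact: cvg_id].
Qed.

Lemma order_stat_density_ge0 n r x : 0 <= x -> 0 <= order_stat_density n r x.
Proof.
move=> x0; rewrite /order_stat_density /rayleigh_density.
by rewrite !mulr_ge0 ?exprn_ge0 ?expR_ge0 ?subr_ge0 ?q_le1// ltW// k_gt0.
Qed.

Lemma integral_order_stat_tail (n r : nat) (x : R) : (r <= n)%N ->
  (\int[leb]_(y in `]x, +oo[ `&` [set y : R | (0 <= y)%R]) (order_stat_density n r y)%:E =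
   (binomial_tail n r (q (Num.max x 0)%R))%:E)%E.
Proof.
move=> rn.
have d0 y : 0 <= y -> 0 <= order_stat_density n r y by exact: order_stat_density_ge0.
have dF (y : R) : is_derive y 1 (fun x => - binomial_tail n r (q x)) (order_stat_density n r y).
  have dG := is_derive1_comp (is_derive_binomial_tail (q y) rn) (is_derive_q y).
  apply: (is_derive1_eq (is_derive1N dG)).
  by rewrite /order_stat_density /rayleigh_density; ring.
have F0 : - binomial_tail n r (q x) @[x --> +oo] --> (0 : R).
  rewrite -[X in _ --> X]oppr0; apply: cvgN.
  have cG : {for (0 : R), continuous (binomial_tail n r)}.
    exact: is_derive1_continuous (is_derive_binomial_tail 0 rn).
  have G0 : binomial_tail n r 0 = 0.
    rewrite /binomial_tail big1// => j _; rewrite expr0n subn_eq0 leqNgt.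
    by rewrite (leq_trans (ltn_ord j))//= mulr0.
  rewrite -[X in _ --> X]G0.
  exact: (@cvg_comp _ _ _ q (binomial_tail n r) _ _ _ cvg_q cG).
by rewrite (integral_tail x d0 (@continuous_order_stat_density n r) dF F0) opprK.
Qed.

End OrderStatisticDensity.

Section OrderStatisticLaw.
Context (R : realType) (d : measure_display) (T : measurableType d).
Variables (P : probability T R) (n r : nat) (D : 'I_n -> T -> R) (k : R).
Hypotheses (k_gt0 : 0 < k) (r_gt0 : (0 < r)%N) (rn : (r <= n)%N).
Hypotheses (mD : forall i, measurable_fun setT (D i)) (indep : mutually_independent P D).
Hypothesis densD : forall i, has_density P (D i) (rayleigh_density k).

Lemma expectation_order_stat (h : R -> R) (B : R) : measurable_fun setT h ->
  (forall x, `|h x| <= B) -> (forall x, 0 < x -> {for x, continuous h}) ->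
  (\int[P]_w (h (order_stat D r w))%:E =
   \int[leb]_y (h (expR (2^-1 * y)%R) * order_stat_density k n r (expR (2^-1 * y)%R) *
                (2^-1 * expR (2^-1 * y))%R)%:E)%E.
Proof.
move=> mh hB ch.
pose N : set R := [set x : R | 0 <= x].
have mN : measurable N by rewrite /N -set_itvcy; exact: measurable_itv.
have mo := measurable_order_stat mD r_gt0 rn.
have mo' : measurable_fun setT (order_stat D r : T -> measurableTypeR R) by exact: mo.
pose X : {RV P >-> measurableTypeR R} :=
  @mfun_Sub _ _ T (measurableTypeR R) (order_stat D r) (mem_set mo').
pose dn := order_stat_density k n r.
have cdn : continuous dn by exact: continuous_order_stat_density.
have mdn : measurable_fun setT dn by exact: continuous_measurable_fun.
(* The formula for the density is nonnegative only on [[0, +oo[], so it is cut off there before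
   being used as a density on the line. *)
have p0 x : 0 <= (dn \_ N) x.
  by rewrite patchE; case: ifPn => // /set_mem; exact: order_stat_density_ge0.
have mp : measurable_fun setT (dn \_ N).
  by apply/(measurable_restrictT dn mN); exact: measurable_funTS.
have tails x : (P (X @^-1` `]x, +oo[) = \int[leb]_(y in `]x, +oo[) ((dn \_ N) y)%:E)%E.
  rewrite (_ : X @^-1` _ = [set w | x < order_stat D r w]); last first.
    by apply/seteqP; split => w /=; rewrite in_itv/= andbT.
  rewrite (@probability_gt_order_stat R _ _ P n D mD indep r x
    (expR (- (k * (Num.max x 0) ^+ 2)))) //; last first.
    by move=> i; rewrite (densD i (measurable_itv _)) integral_rayleigh_tail.
  rewrite -[LHS]/((binomial_tail n r (expR (- (k * (Num.max x 0) ^+ 2))))%:E).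
  rewrite -integral_order_stat_tail// integral_mkcondr.
  by apply: eq_integral => y _; rewrite restrict_EFin.
have := @expectation_density R _ _ P X (dn \_ N) p0 mp tails h B mh hB.
rewrite /= => ->.
transitivity (\int[leb]_(x in N) (h x * dn x)%:E)%E.
  rewrite [RHS]integral_mkcond; apply: eq_integral => x _.
  by rewrite !patchE; case: ifP => _; rewrite ?mulr0.
rewrite /N -set_itvcy -integral_itv_obnd_cbnd; last first.
  by apply/measurable_EFinP; apply: measurable_funTS; exact: measurable_funM.
rewrite set_itvoy (@integral_expR_subst R 2^-1 (fun x => h x * dn x))//.
by move=> x x0; apply: cvgM; [exact: ch|exact: cdn].
Qed.

End OrderStatisticLaw.

(** * The Laplace functional of the distance *)

(* Adding a positive real number moves the argument towards [0]. *)
Lemma normr_subr_atan_le (R : realType) (A B psi : R) : 0 <= A -> 0 < B -> `|psi| < pi / 2 ->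
  `|psi - atan (B * sin psi / (A + B * cos psi))| <= `|psi|.
Proof.
move=> A0 B0 psib; have psiI : - (pi / 2) < psi < pi / 2 by rewrite -ltr_norml.
have c0 : 0 < cos psi by rewrite cos_gt0_pihalf.
have den0 : 0 < A + B * cos psi by rewrite ltr_wpDl// mulr_gt0.
have tanE : psi = atan (tan psi) by rewrite tanK// in_itv.
(* The quotient has the sign of [sin psi], and so has this difference. By monotonicity of the
   arctangent, the new argument lies between [0] and [psi]. *)
have diff : tan psi - B * sin psi / (A + B * cos psi) =
    sin psi * (A / (cos psi * (A + B * cos psi))).
  by rewrite /tan; field; rewrite !gt_eqF.
have w0 : 0 <= A / (cos psi * (A + B * cos psi)) by rewrite divr_ge0// mulr_ge0// ltW.
have w1 : 0 <= B / (A + B * cos psi) by rewrite divr_ge0 ?ltW.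
have [p0|p0] := leP 0 psi.
- have s0 : 0 <= sin psi by rewrite sin_ge0_pi//; have := pi_gt0 R; case/andP : psiI => *; lra.
  have h1 : 0 <= atan (B * sin psi / (A + B * cos psi)).
    by rewrite -[leLHS]atan0 le_atan// mulrAC mulr_ge0.
  have h2 : atan (B * sin psi / (A + B * cos psi)) <= psi.
    by rewrite {3}tanE le_atan// -subr_ge0 diff mulr_ge0.
  by rewrite !ger0_norm// ?subr_ge0// lerBlDr lerDl.
- have s0 : sin psi <= 0.
    rewrite -[psi]opprK sinN oppr_le0 sin_ge0_pi//; have := pi_gt0 R.
    by case/andP : psiI => *; lra.
  have h1 : atan (B * sin psi / (A + B * cos psi)) <= 0.
    by rewrite -[leRHS]atan0 le_atan// mulrAC mulr_ge0_le0.
  have h2 : psi <= atan (B * sin psi / (A + B * cos psi)).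
    by rewrite {1}tanE le_atan// -subr_le0 diff mulr_le0_ge0.
  by rewrite [leRHS]ltr0_norm// ler0_norm ?subr_le0// opprB lerBlDr; lra.
Qed.

Section NOMA.
Context (R : realType) (alpha : R) (s : R[i]).
Hypotheses (alpha_gt2 : 2 < alpha) (s_gt0 : 0 < complex.Re s).

Let S : R[i] := cpow s (2 / alpha)%:C.
Let w : R[i] := (2 / alpha)%:C * cLog s.

Let SE : S = cexp w. Proof. exact: cpowE. Qed.

Let alpha_gt0 : 0 < alpha. Proof. exact: lt_trans alpha_gt2. Qed.

Let Imw : complex.Im w = 2 / alpha * complex.Im (cLog s).
Proof. by rewrite /w ImM/= mul0r addr0. Qed.

Let Imw_lt : `|complex.Im w| < pi / 2.
Proof.
rewrite Imw normrM; apply: le_lt_trans (Im_cLog_lt s_gt0).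
rewrite ler_piMl// ger0_norm ?divr_ge0 ?(ltW alpha_gt0)//.
by rewrite ler_pdivrMr ?mul1r ?alpha_gt0// ltW// alpha_gt2.
Qed.

Let ReS_gt0 : 0 < complex.Re S. Proof. by rewrite SE; exact: Re_cexp_gt0 Imw_lt. Qed.

Lemma Re_rate_gt0 (p m omega : R) : 0 < p -> 0 < m -> 0 < omega ->
  0 < complex.Re (p%:C * (m%:C + omega%:C * S)).
Proof.
move=> p0 m0 o0; have S0 := ReS_gt0.
rewrite ReM ReD (ReM omega%:C) [complex.Re _%:C]/= [complex.Im _%:C]/= !mul0r !subr0.
by rewrite mulr_gt0// addr_gt0// mulr_gt0.
Qed.

(** This is the branch condition of [laplace_foxH]. Because [alpha > 2], the principal argument of
    [S] is [2 / alpha] times that of [s]; factoring out [alpha / 2] leaves [arg S - arg b], to which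
    [normr_subr_atan_le] applies. *)
Lemma arg_rate (p m omega : R) : 0 < p -> 0 < m -> 0 < omega ->
  `|complex.Im (cLog s) - alpha / 2 * complex.Im (cLog (p%:C * (m%:C + omega%:C * S)))| < pi / 2.
Proof.
move=> p0 m0 o0; have b0 := Re_rate_gt0 p0 m0 o0; have a0 := alpha_gt0.
set b := p%:C * _ in b0 *.
have argb : complex.Im (cLog b) = atan (omega * expR (complex.Re w) * sin (complex.Im w) /
    (m + omega * expR (complex.Re w) * cos (complex.Im w))).
  rewrite -[complex.Im (cLog b)]/(carg b) /carg b0; congr atan.
  have ReE : complex.Re b = p * (m + omega * expR (complex.Re w) * cos (complex.Im w)).
    rewrite /b SE ReM ReD (ReM omega%:C) Re_cexp.
    by rewrite [complex.Re _%:C]/= [complex.Im _%:C]/= !mul0r !subr0 mulrA.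
  have ImE : complex.Im b = p * (omega * expR (complex.Re w) * sin (complex.Im w)).
    rewrite /b SE ImM ImD (ImM omega%:C) Im_cexp.
    by rewrite /=; ring.
  rewrite ReE ImE -mulf_div divff ?mul1r// gt_eqF//.
have ImsE : complex.Im (cLog s) = alpha / 2 * complex.Im w.
  by rewrite Imw; field; rewrite gt_eqF.
rewrite argb [X in `|X - _|]ImsE -mulrBr normrM.
have o1 : 0 < omega * expR (complex.Re w) by rewrite mulr_gt0 ?expR_gt0.
apply: (@le_lt_trans _ _ (`|alpha / 2| * `|complex.Im w|)).
  by rewrite ler_wpM2l ?normr_ge0// normr_subr_atan_le ?(ltW m0) ?Imw_lt.
by rewrite -normrM -ImsE; exact: Im_cLog_lt.
Qed.

Variables (lamb omega : R).
Hypotheses (lamb_gt0 : 0 < lamb) (omega_gt0 : 0 < omega).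

Let g (a x : R) : R[i] := cexp (- (a%:C * s * (x `^ alpha)%:C)
          - (pi * lamb * omega * x ^+ 2)%:C * S).

Let E1 (a x : R) := - (a * complex.Re s * x `^ alpha) - pi * lamb * omega * x ^+ 2 * complex.Re S.
Let E2 (a x : R) := - (a * complex.Im s * x `^ alpha) - pi * lamb * omega * x ^+ 2 * complex.Im S.

Let gE a x : g a x = cexp (E1 a x +i* E2 a x).
Proof.
rewrite /g; congr cexp; apply: complex_eq.
- rewrite ReD !ReN (ReM _ (x `^ alpha)%:C) (ReM a%:C) (ReM _ S) /E1.
  by rewrite [complex.Re _%:C]/= [complex.Im _%:C]/= !mul0r ?mulr0 !subr0.
- rewrite ImD !ImN (ImM _ (x `^ alpha)%:C) (ImM a%:C) (ImM _ S) /E2.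
  by rewrite [complex.Re _%:C]/= [complex.Im _%:C]/= !mul0r ?mulr0 ?add0r !addr0.
Qed.

Let E1_le0 a x : 0 <= a -> E1 a x <= 0.
Proof.
move=> a0; rewrite /E1 -opprD oppr_le0 addr_ge0//.
  by rewrite !mulr_ge0 ?powR_ge0// ltW// s_gt0.
exact: mulr_ge0 (mulr_ge0 (mulr_ge0 (mulr_ge0 (pi_ge0 R) (ltW lamb_gt0)) (ltW omega_gt0))
  (sqr_ge0 x)) (ltW ReS_gt0).
Qed.

Let normc_g_le1 a x : 0 <= a -> nrmc (g a x) <= 1.
Proof. by move=> a0; rewrite gE normc_cexp -[leRHS]expR0 ler_expR E1_le0. Qed.

Let measurable_E (u v : R) :
  measurable_fun setT (fun x : R => - (u * x `^ alpha) - pi * lamb * omega * x ^+ 2 * v).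
Proof.
apply: measurable_funB; last first.
  by apply: measurable_funM => //; apply: measurable_funM => //; exact: measurable_funX.
by apply: measurableT_comp => //; apply: measurable_funM => //; exact: measurable_powR.
Qed.

Let Cmeasurable_g a : Cmeasurable (g a : R -> R[i]).
Proof.
rewrite (_ : g a = (fun x => cexp (E1 a x +i* E2 a x))); last by apply/funext => x; rewrite gE.
by apply: Cmeasurable_cexp; split => /=; exact: measurable_E.
Qed.

Let continuous_E (u v : R) (x : R) : 0 < x ->
  {for x, continuous (fun x : R => - (u * x `^ alpha) - pi * lamb * omega * x ^+ 2 * v)}.
Proof.
move=> x0; apply: cvgB.
  apply: cvgN; apply: cvgM; first exact: cvg_cst.
  exact: (is_derive1_continuous (is_derive1_powR alpha x0)).
by apply: cvgM; [apply: cvgM; [exact: cvg_cst|exact: exprn_continuous]|exact: cvg_cst].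
Qed.

Let continuous_Re_g a (x : R) : 0 < x -> {for x, continuous (fun x => complex.Re (g a x))}.
Proof.
move=> x0; rewrite (_ : (fun x => _) = (fun x => expR (E1 a x) * cos (E2 a x))); last first.
  by apply/funext => y; rewrite gE Re_cexp.
apply: cvgM.
- by apply: (@continuous_comp R R R (E1 a) expR x); [exact: continuous_E|exact: continuous_expR].
- by apply: (@continuous_comp R R R (E2 a) cos x); [exact: continuous_E|exact: continuous_cos].
Qed.

Let continuous_Im_g a (x : R) : 0 < x -> {for x, continuous (fun x => complex.Im (g a x))}.
Proof.
move=> x0; rewrite (_ : (fun x => _) = (fun x => expR (E1 a x) * sin (E2 a x))); last first.
  by apply/funext => y; rewrite gE Im_cexp.
apply: cvgM.
- by apply: (@continuous_comp R R R (E1 a) expR x); [exact: continuous_E|exact: continuous_expR].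
- by apply: (@continuous_comp R R R (E2 a) sin x); [exact: continuous_E|exact: continuous_sin].
Qed.

Context (d : measure_display) (T : measurableType d).
Variables (P : probability T R) (n r : nat) (D : 'I_n -> T -> R) (c : R).
Hypotheses (c_gt0 : 0 < c) (r_gt0 : (0 < r)%N) (rn : (r <= n)%N).
Hypotheses (mD : forall i, measurable_fun setT (D i)) (indep : mutually_independent P D).
Hypothesis densD : forall i, has_density P (D i) (fd c lamb).

Let k := c * lamb * pi.

Let k_gt0 : 0 < k. Proof. by rewrite !mulr_gt0 ?pi_gt0. Qed.

Let densD' i : has_density P (D i) (rayleigh_density k).
Proof.
rewrite (_ : rayleigh_density k = fd c lamb)//; apply/funext => x.
by rewrite /rayleigh_density /fd /k; ring.
Qed.

(** The integer counts powers of [q]: [n - r] from the points beyond the distance, [l] from the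
    binomial expansion of [(1 - q)^(r-1)], and one from [rayleigh_density]. *)
Let rate (l : nat) : R[i] := ((n - r + l + 1)%:R * c)%:C + omega%:C * S.

Lemma phi_Cint a : 0 <= a -> phi P D r alpha lamb omega a s =
  Cint leb (fun y : R => g a (expR (2^-1 * y)) *
    (order_stat_density k n r (expR (2^-1 * y)) * (2^-1 * expR (2^-1 * y)))%:C).
Proof.
move=> a0; have [m1 m2] := Cmeasurable_g a.
rewrite /phi /cexpect; apply: complex_eq; congr fine.
- rewrite (expectation_order_stat k_gt0 r_gt0 rn mD indep densD' m1 (B := 1)).
  + by apply: eq_integral => y _; rewrite Re_mulr_real mulrA.
  + by move=> x; exact: le_trans (normr_Re_le _) (normc_g_le1 x a0).
  + by move=> x; exact: continuous_Re_g.
- rewrite (expectation_order_stat k_gt0 r_gt0 rn mD indep densD' m2 (B := 1)).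
  + by apply: eq_integral => y _; rewrite Im_mulr_real mulrA.
  + by move=> x; exact: le_trans (normr_Im_le _) (normc_g_le1 x a0).
  + by move=> x; exact: continuous_Im_g.
Qed.

Let integrandE a y : g a (expR (2^-1 * y)) *
    (order_stat_density k n r (expR (2^-1 * y)) * (2^-1 * expR (2^-1 * y)))%:C =
  \sum_(l < r) (r%:R * 'C(n, r)%:R * k * ((-1) ^+ l * 'C(r.-1, l)%:R))%:C *
    cexp (y%:C - (pi * lamb)%:C * rate l * (expR y)%:C - a%:C * s * (expR (alpha / 2 * y))%:C).
Proof.
set Q := expR (- (k * expR y)).
have sq : expR (2^-1 * y) ^+ 2 = expR y.
  by rewrite expr2 -expRD; congr expR; field.
(* The Jacobian [x / 2] combines with [2 k x] into [k x^2 = k exp y]. *)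
have densE : order_stat_density k n r (expR (2^-1 * y)) * (2^-1 * expR (2^-1 * y)) =
    r%:R * 'C(n, r)%:R * k * expR y * (1 - Q) ^+ r.-1 * Q ^+ (n - r).+1.
  by rewrite /order_stat_density /rayleigh_density sq -/Q exprS -sq; field.
have powE : expR (2^-1 * y) `^ alpha = expR (alpha / 2 * y).
  by rewrite -expRM; congr expR; field.
rewrite densE exprBn prednK// mulr_sumr mulr_suml rmorph_sum/= mulr_sumr.
apply: eq_bigr => l _.
have QX m : Q ^+ m = expR (- (k * m%:R * expR y)).
  by rewrite /Q -expRM_natl; congr expR; ring.
rewrite expr1n mulr1 -[_ *+ 'C(r.-1, l)]mulr_natr.
have -> : r%:R * 'C(n, r)%:R * k * expR y * ((-1) ^+ l * Q ^+ l * 'C(r.-1, l)%:R) *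
     Q ^+ (n - r).+1 =
   (r%:R * 'C(n, r)%:R * k * ((-1) ^+ l * 'C(r.-1, l)%:R)) *
   expR (y - k * (n - r + l + 1)%:R * expR y).
  rewrite (_ : (n - r + l + 1)%N = ((n - r).+1 + l)%N); last by rewrite addn1 addSn.
  by rewrite expRD -QX exprD; ring.
rewrite rmorphM/= mulrCA -cexp_real -cexpD; congr (_ * cexp _).
rewrite /rate powE sq /k; apply: complex_eq.
- by rewrite !(ReD, ReN, ReM, ImD, ImN, ImM)/=; ring.
- by rewrite !(ReD, ReN, ReM, ImD, ImN, ImM)/=; ring.
Qed.

Let m_gt0 l : 0 < (n - r + l + 1)%:R * c.
Proof. by rewrite mulr_gt0// addn1 ltr0n. Qed.

Lemma phi_foxH (gam a : R) : 0 < gam -> gam < 2 / alpha -> 0 <= a ->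
  phi P D r alpha lamb omega a s =
  (c * r%:R * 'C(n, r)%:R)%:C * \sum_(l < r)
    (((-1) ^+ l * 'C(r.-1, l)%:R)%:C *
     foxH alpha gam (a%:C * s * cpow ((pi * lamb)%:C * rate l) (- (alpha / 2))%:C) / rate l).
Proof.
move=> g0 ga a0; rewrite phi_Cint// (funext (integrandE a)).
have pl0 : 0 < pi * lamb by rewrite mulr_gt0 ?pi_gt0.
have ReB l : 0 < complex.Re ((pi * lamb)%:C * rate l) by exact: Re_rate_gt0.
pose f l y := cexp (y%:C - (pi * lamb)%:C * rate l * (expR y)%:C -
  a%:C * s * (expR (alpha / 2 * y))%:C).
have mf l : Cmeasurable (f l : measurableTypeR R -> R[i]).
  apply: Cmeasurable_cexp; apply: CmeasurableD; first apply: CmeasurableD.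
  - exact: Cmeasurable_real.
  - apply: CmeasurableN; apply: CmeasurableM; first exact: Cmeasurable_cst.
    by apply: Cmeasurable_real; exact: measurable_expR.
  - apply: CmeasurableN; apply: CmeasurableM; first exact: Cmeasurable_cst.
    by apply: Cmeasurable_real; apply: measurableT_comp => //; exact: measurable_funM.
have fle l y : nrmc (f l y) <= expR (1 * y - complex.Re ((pi * lamb)%:C * rate l) * expR y).
  rewrite /f normc_cexp ler_expR mul1r ReD ReD ReN ReN (ReM (_ * rate l)) (ReM (a%:C * s)).
  rewrite (ReM a%:C) [complex.Re _%:C]/= [complex.Im _%:C]/= !mulr0 !mul0r !subr0.
  by rewrite gerBl !mulr_ge0 ?expR_ge0// ltW// s_gt0.
have fi l : Cintegrable leb (f l).
  exact: (@le_Cintegrable R _ (measurableTypeR R) leb _ _ (mf l) (fle l)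
    (integrable_expR_gamma ltr01 (ReB l))).
pose kf l : R[i] := (r%:R * 'C(n, r)%:R * k * ((-1) ^+ l * 'C(r.-1, l)%:R))%:C.
have kfi l : Cintegrable leb (fun y => kf l * f l y).
  apply: (@le_Cintegrable R _ (measurableTypeR R) leb _ (fun y => nrmc (kf l) *
    expR (1 * y - complex.Re ((pi * lamb)%:C * rate l) * expR y))).
  - by apply: CmeasurableM; [exact: Cmeasurable_cst|exact: mf].
  - by move=> y; rewrite Normc.normcM ler_wpM2l ?normc_ge0.
  - exact: integrableMl (integrable_expR_gamma ltr01 (ReB l)).
rewrite (Cint_sum r kfi) mulr_sumr; apply: eq_bigr => l _.
rewrite CintZ; last exact: fi.
rewrite (laplace_foxH alpha_gt2 g0 ga a0 s_gt0 (ReB l) (arg_rate pl0 (m_gt0 l) omega_gt0)).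
(* The factor [pi lamb] contained in [k] cancels the one in the denominator [pi lamb rate l]
   supplied by [laplace_foxH], leaving the constant [c] in front. *)
have kE : kf l = (pi * lamb)%:C * (c * r%:R * 'C(n, r)%:R)%:C * ((-1) ^+ l * 'C(r.-1, l)%:R)%:C.
  by rewrite /kf -!rmorphM/=; congr (_%:C); rewrite /k; ring.
have pl1 : (pi * lamb)%:C != 0 :> R[i].
  by apply/eqP => /(congr1 (@complex.Re R)) /= h; move: pl0; rewrite h ltxx.
have rl0 : rate l != 0.
  by apply/eqP => h; have := ReB l; rewrite h mulr0 /= ltxx.
set H := foxH _ _ _; rewrite kE invfM.
rewrite [LHS](_ : _ = ((pi * lamb)%:C * (pi * lamb)%:C^-1) * ((c * r%:R * 'C(n, r)%:R)%:C *
  (((-1) ^+ l * 'C(r.-1, l)%:R)%:C * H / rate l))); last by ring.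
by rewrite divff// mul1r.
Qed.

Let order_stat_cvg (a : nat -> R) (x : R) : a m @[m --> \oo] --> (0 : R) ->
  complex.Re (g (a m) x) @[m --> \oo] --> complex.Re (g 0 x) /\
  complex.Im (g (a m) x) @[m --> \oo] --> complex.Im (g 0 x).
Proof.
move=> a0.
have cE (u v : R) : - (a m * u * x `^ alpha) - v @[m --> \oo] --> - (0 * u * x `^ alpha) - v.
  apply: cvgB; last exact: cvg_cst.
  apply: cvgN; apply: cvgM; last exact: cvg_cst.
  by apply: cvgM => //; exact: cvg_cst.
split.
- under eq_fun do rewrite gE Re_cexp/=; rewrite gE Re_cexp/=.
  apply: cvgM.
  + apply: (@cvg_comp _ _ _ (fun m => E1 (a m) x) expR _ (nbhs (E1 0 x)));
      last exact: continuous_expR.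
    exact: cE (complex.Re s) (pi * lamb * omega * x ^+ 2 * complex.Re S).
  + apply: (@cvg_comp _ _ _ (fun m => E2 (a m) x) cos _ (nbhs (E2 0 x)));
      last exact: continuous_cos.
    exact: cE (complex.Im s) (pi * lamb * omega * x ^+ 2 * complex.Im S).
- under eq_fun do rewrite gE Im_cexp/=; rewrite gE Im_cexp/=.
  apply: cvgM.
  + apply: (@cvg_comp _ _ _ (fun m => E1 (a m) x) expR _ (nbhs (E1 0 x)));
      last exact: continuous_expR.
    exact: cE (complex.Re s) (pi * lamb * omega * x ^+ 2 * complex.Re S).
  + apply: (@cvg_comp _ _ _ (fun m => E2 (a m) x) sin _ (nbhs (E2 0 x)));
      last exact: continuous_sin.
    exact: cE (complex.Im s) (pi * lamb * omega * x ^+ 2 * complex.Im S).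
Qed.

(** The integrand has modulus at most [1] for every [a >= 0], so dominated convergence along
    sequences applies under the probability measure. *)
Lemma cvg_phi :
  (fun a => complex.Re (phi P D r alpha lamb omega a s)) @ 0^'+ -->
    complex.Re (phi P D r alpha lamb omega 0 s) /\
  (fun a => complex.Im (phi P D r alpha lamb omega a s)) @ 0^'+ -->
    complex.Im (phi P D r alpha lamb omega 0 s).
Proof.
have mo := measurable_order_stat mD r_gt0 rn.
have i1 : P.-integrable setT (EFin \o (fun=> 1 : R)) by exact: finite_measure_integrable_cst.
split; apply/cvg_at_rightP => a [a0 alim].
- apply: (@cvg_Rintegral_dominated R _ T P (fun m w => complex.Re (g (a m) (order_stat D r w))) _
    (fun=> 1)) => //.
  + by move=> m; have [m1 _] := Cmeasurable_g (a m); exact: (measurableT_comp m1 mo).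
  + by have [m1 _] := Cmeasurable_g 0; exact: (measurableT_comp m1 mo).
  + by move=> x; have [] := order_stat_cvg (order_stat D r x) alim.
  + move=> m x; apply: le_trans (normr_Re_le _) _; apply: normc_g_le1.
    exact: ltW.
- apply: (@cvg_Rintegral_dominated R _ T P (fun m w => complex.Im (g (a m) (order_stat D r w))) _
    (fun=> 1)) => //.
  + by move=> m; have [_ m1] := Cmeasurable_g (a m); exact: (measurableT_comp m1 mo).
  + by have [_ m1] := Cmeasurable_g 0; exact: (measurableT_comp m1 mo).
  + by move=> x; have [] := order_stat_cvg (order_stat D r x) alim.
  + move=> m x; apply: le_trans (normr_Im_le _) _; apply: normc_g_le1.
    exact: ltW.
Qed.

End NOMA.

Unset Implicit Arguments.

Theorem theorem2 (R : realType) (dsp : measure_display) (T : measurableType dsp)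
  (Pr : probability T R) (K r : nat) (D : 'I_(2 * K) -> T -> R)
  (alpha lamb Pw sig2 omega gam : R) (s : R[i]) :
  (0 < K)%N -> (0 < r)%N -> (r <= 2 * K)%N ->
  2 < alpha -> 0 < lamb -> 0 < Pw -> 0 <= sig2 -> 0 < omega ->
  0 < gam -> gam < 2 / alpha ->
  0 < complex.Re s ->
  (forall i, measurable_fun setT (D i)) ->
  mutually_independent Pr D ->
  (forall i, has_density Pr (D i) (fd (cNOMA R) lamb)) ->
  let den (l : nat) : R[i] :=
    ((2 * K - r + l + 1)%:R * cNOMA R)%:C + omega%:C * cpow s (2 / alpha)%:C in
  let coef (l : nat) : R[i] := ((-1) ^+ l * 'C(r.-1, l)%:R)%:C in
  let pref : R[i] := (cNOMA R * r%:R * 'C(2 * K, r)%:R)%:C in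
  let L : R[i] := pref * \sum_(l < r) (coef l / den l) in
  phi Pr D r alpha lamb omega (sig2 / Pw) s =
    pref * \sum_(l < r)
      (coef l *
       foxH alpha gam ((sig2 / Pw)%:C * s * cpow ((pi * lamb)%:C * den l) (- (alpha / 2))%:C)
       / den l)
  /\ (fun a => complex.Re (phi Pr D r alpha lamb omega a s)) @ 0^'+ --> complex.Re L
  /\ (fun a => complex.Im (phi Pr D r alpha lamb omega a s)) @ 0^'+ --> complex.Im L.
Proof.
move=> K0 r0 rK a2 l0 P0 s0 o0 g0 ga Res mD indep dens den coef pref L.
have c0 : 0 < cNOMA R by rewrite /cNOMA divr_gt0.
have formula a : 0 <= a -> phi Pr D r alpha lamb omega a s = pref * \sum_(l < r)
    (coef l * foxH alpha gam (a%:C * s * cpow ((pi * lamb)%:C * den l) (- (alpha / 2))%:C)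
     / den l).
  by move=> a0; exact: (phi_foxH a2 Res l0 o0 c0 r0 rK mD indep dens g0 ga a0).
(* The formula is also valid at [a = 0], where [foxH] takes its value [1] at the origin; the limit
   is therefore the right-continuity of [phi] at [0]. *)
have LE : L = phi Pr D r alpha lamb omega 0 s.
  rewrite formula//; congr (_ * _); apply: eq_bigr => l _.
  by rewrite !mul0r /foxH eqxx mulr1.
split; first by rewrite formula// divr_ge0// ltW.
by rewrite LE; exact: cvg_phi.
Qed.
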